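(* Let $G_{24}$ be the extended binary Golay matroid. Neither the Kazhdan--Lusztig polynomial $P_{G_{24}}(t)$ nor the $Z$-polynomial $Z_{G_{24}}(t)$ is real-rooted, i.e. each of them has at least one non-real complex root. The extended binary Golay matroid is therefore a counterexample to the conjecture that $P_M(t)$ is real-rooted for every matroid $M$ and to the conjecture that $Z_M(t)$ is real-rooted for every matroid $M$.
   Context: The extended binary Golay code is the binary linear code of length $24$, dimension $12$ and minimum distance $8$ (unique up to permutation of coordinates). $G_{24}$ is the rank-$12$ matroid on the $24$ columns of a generator matrix of this code, with independence meaning linear independence over $\mathbb F_2$. For a loopless matroid $M$ of rank $\mathrm{rk}\,M$, let $\chi_M(t)=\sum_{F}\mu(\varnothing,F)\,t^{\mathrm{rk}\,M-\mathrm{rk}\,F}$ be its characteristic polynomial, where $F$ runs over the flats of $M$ and $\mu$ is the Möbius function of the lattice of flats. The Kazhdan--Lusztig polynomial $P_M(t)\in\mathbb Z[t]$ is defined for all loopless matroids by the unique assignment such that $P_M(t)=1$ if $\mathrm{rk}\,M=0$; $\deg P_M(t)<\tfrac12\mathrm{rk}\,M$ if $\mathrm{rk}\,M>0$; and $$t^{\mathrm{rk}\,M}P_M(t^{-1})=\sum_{F}\chi_{M|F}(t)\,P_{M/F}(t),$$ the sum being over all flats $F$ of $M$, where $M|F$ is the restriction to $F$ and $M/F$ is the contraction of $F$. The $Z$-polynomial is $$Z_M(t)=\sum_{F}t^{\mathrm{rk}\,F}P_{M/F}(t),$$ the sum again being over all flats $F$ of $M$. A polynomial with real coefficients is real-rooted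 if all its complex roots are real. *)

(* Defs.v *)
From HB Require Import structures.
From mathcomp Require Import all_boot all_order all_algebra.
From mathcomp Require Import zify.
From mathcomp Require Import complex.
From mathcomp Require Import reals.

Set Implicit Arguments.
Unset Strict Implicit.
Unset Printing Implicit Defensive.
Import Order.TTheory GRing.Theory Num.Theory.
Local Open Scope ring_scope.

Definition matroid_axiom (T : finType) (E : {set T}) (I : {set {set T}}) : bool :=
  [&& set0 \in I,
      [forall J in I, J \subset E],
      [forall J in I, [forall K : {set T}, (K \subset J) ==> (K \in I)]] &
      [forall J in I, forall K in I, (#|J| < #|K|)%N ==>
         [exists x in K :\: J, x |: J \in I]]].

(* The ground set is a subset of a fixed finite type, so that restrictions and
   contractions of M live in the same type as M. *)
Record matroid (T : finType) := Matroid {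
  ground : {set T};
  indep : {set {set T}};
  matroidP : matroid_axiom ground indep }.

Section MatroidTheory.
Variable T : finType.
Implicit Types (M : matroid T) (A B F G H J K E : {set T}).

Lemma matroid_axiomP E (I : {set {set T}}) :
  reflect [/\ set0 \in I,
     forall J, J \in I -> J \subset E,
     forall J K, J \in I -> K \subset J -> K \in I &
     forall J K, J \in I -> K \in I -> (#|J| < #|K|)%N ->
       exists x, [/\ x \in K, x \notin J & x |: J \in I]]
   (matroid_axiom E I).
Proof.
apply: (iffP and4P) => -[h0 h1 h2 h3]; split=> //.
- by move=> J JI; apply: (implyP (forallP h1 J)).
- move=> J K JI; move: K; have /forallP h := implyP (forallP h2 J) JI.
  by move=> K; apply/implyP/h.
- move=> J K JI KI ltJK.
  have /exists_inP [x] := implyP (implyP (forallP (implyP (forallP h3 J) JI) K) KI) ltJK.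
  by rewrite inE => /andP [xJ xK] xI; exists x.
- by apply/forall_inP.
- by apply/forall_inP => J JI; apply/forallP => K; apply/implyP; apply: h2.
- apply/forall_inP => J JI; apply/forall_inP => K KI; apply/implyP => lt.
  by have [x [xK xJ xI]] := h3 _ _ JI KI lt; apply/exists_inP; exists x; rewrite ?inE ?xK ?xJ.
Qed.

Lemma indep0 M : set0 \in indep M.
Proof. by have /matroid_axiomP [] := matroidP M. Qed.

Lemma indep_ground M J : J \in indep M -> J \subset ground M.
Proof. by have /matroid_axiomP [_ h _ _] := matroidP M; apply: h. Qed.

Lemma indepS M J K : K \subset J -> J \in indep M -> K \in indep M.
Proof. by have /matroid_axiomP [_ _ h _] := matroidP M => s Ji; apply: h s. Qed.

Lemma indep_aug M J K : J \in indep M -> K \in indep M -> (#|J| < #|K|)%N ->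
  exists x, [/\ x \in K, x \notin J & x |: J \in indep M].
Proof. by have /matroid_axiomP [_ _ _ h] := matroidP M; apply: h. Qed.

Lemma matroid_eq M1 M2 : ground M1 = ground M2 -> indep M1 = indep M2 -> M1 = M2.
Proof.
case: M1 M2 => [E1 I1 h1] [E2 I2 h2] /= eE eI; subst E2 I2.
by rewrite (bool_irrelevance h1 h2).
Qed.

Definition rk M A : nat := \max_(J in indep M | J \subset A) #|J|.
Definition rank M : nat := rk M (ground M).

Definition loopless M : bool := [forall x in ground M, [set x] \in indep M].

Definition flat M F : bool :=
  (F \subset ground M) &&
  [forall x in ground M :\: F, (rk M F < rk M (x |: F))%N].

Definition flats M : {set {set T}} := [set F | flat M F].

Lemma rk_geq M A J : J \in indep M -> J \subset A -> (#|J| <= rk M A)%N.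
Proof.
move=> Ji JA; by apply: (@leq_bigmax_cond _ _ (fun J : {set T} => #|J|)); rewrite Ji JA.
Qed.

Lemma rk_ex M A : exists B, [/\ B \in indep M, B \subset A & #|B| = rk M A].
Proof.
have : (0 < #|[pred J | (J \in indep M) && (J \subset A)]|)%N.
  by apply/card_gt0P; exists set0; rewrite inE indep0 sub0set.
case/(eq_bigmax_cond (fun J : {set T} => #|J|)) => B.
rewrite inE => /andP [Bi BA] e; exists B; split=> //; rewrite -e.
Qed.

Lemma restr_subproof M A :
  matroid_axiom (ground M :&: A) [set J in indep M | J \subset A].
Proof.
apply/matroid_axiomP; split.
- by rewrite inE indep0 sub0set.
- by move=> J; rewrite inE => /andP [Ji JA]; rewrite subsetI JA indep_ground.
- move=> J K; rewrite !inE => /andP [Ji JA] KJ.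
  by rewrite (indepS KJ Ji) (subset_trans KJ JA).
- move=> J K; rewrite !inE => /andP [Ji JA] /andP [Ki KA] lt.
  have [x [xK xJ xi]] := indep_aug Ji Ki lt; exists x; split=> //.
  by rewrite inE xi subUset sub1set (subsetP KA).
Qed.

Definition restr M A : matroid T := Matroid (restr_subproof M A).

Lemma contr_subproof M A :
  matroid_axiom (ground M :\: A)
    [set J : {set T} | (J \subset ground M :\: A) &&
       [exists B in indep M,
          [&& B \subset A, #|B| == rk M A & J :|: B \in indep M]]].
Proof.
apply/matroid_axiomP; split.
- have [B [Bi BA cB]] := rk_ex M A.
  rewrite inE sub0set; apply/exists_inP; exists B => //.
  by rewrite BA cB eqxx set0U.
- by move=> J; rewrite inE => /andP [].
- move=> J K; rewrite !inE => /andP [JE /exists_inP [B Bi /and3P [BA cB JB]]] KJ.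
  rewrite (subset_trans KJ JE); apply/exists_inP; exists B => //.
  by rewrite BA cB (indepS _ JB) // setSU.
- move=> J K; rewrite !inE => /andP [JE /exists_inP [B Bi /and3P [BA /eqP cB JB]]].
  case/andP=> KE /exists_inP [B' Bi' /and3P [BA' /eqP cB' KB']] lt.
  have dis (L D : {set T}) : L \subset ground M :\: A -> D \subset A -> #|L :|: D| = (#|L| + #|D|)%N.
    move=> LE DA; apply/eqP; rewrite (leq_card_setU L D).2.
    rewrite -setI_eq0; apply/eqP/setP => x; rewrite !inE; apply/negP => /andP [xL xD].
    by have := subsetP LE _ xL; rewrite inE (subsetP DA).
  have lt2 : (#|J :|: B| < #|K :|: B'|)%N by rewrite !dis // cB cB' ltn_add2r.
  have [x [xK xJ xi]] := indep_aug JB KB' lt2.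
  have xA : x \notin A.
    apply/negP => xA.
    have h : x |: B \in indep M by apply: indepS xi; rewrite setUS // subsetUr.
    suff: (#|x |: B| <= rk M A)%N.
      by rewrite cardsU1 -cB; move: xJ; rewrite inE negb_or => /andP [_ ->]; rewrite ltnn.
    by apply: rk_geq => //; rewrite subUset sub1set xA.
  have xK' : x \in K.
    by move: xK; rewrite inE => /orP [//|/(subsetP BA')]; rewrite (negPf xA).
  exists x; split=> //.
    by move: xJ; rewrite inE negb_or => /andP [].
  rewrite inE subUset sub1set (subsetP KE) // JE; apply/exists_inP; exists B => //.
  by rewrite BA cB eqxx -setUA xi.
Qed.

(* J is independent in M / A when J :|: B is independent in M for some basis B
   of A. *)
Definition contr M A : matroid T := Matroid (contr_subproof M A).

Lemma rk_ext M A J : J \in indep M -> J \subset A ->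
  exists B, [/\ B \in indep M, J \subset B, B \subset A & #|B| = rk M A].
Proof.
move: {2}(rk M A - #|J|)%N (leqnn (rk M A - #|J|)%N) => n.
elim: n J => [|n IH] J le Ji JA.
  exists J; split=> //; apply/eqP; rewrite eqn_leq rk_geq //=.
  by move: le; rewrite leqn0 subn_eq0.
have [eq|ne] := eqVneq #|J| (rk M A); first by exists J.
have lt : (#|J| < rk M A)%N by rewrite ltn_neqAle ne rk_geq.
have [B [Bi BA cB]] := rk_ex M A; rewrite -cB in lt.
have [x [xB xJ xi]] := indep_aug Ji Bi lt.
have [] := IH (x |: J) => //.
- by rewrite cardsU1 xJ; lia.
- by rewrite subUset sub1set JA (subsetP BA).
move=> C [Ci xJC CA cC]; exists C; split=> //.
by apply: subset_trans xJC; rewrite subsetUr.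
Qed.

Lemma rkS M A B : A \subset B -> (rk M A <= rk M B)%N.
Proof.
have [J [Ji JA <-]] := rk_ex M A => AB.
by apply: rk_geq => //; apply: subset_trans AB.
Qed.

Lemma rk0 M : rk M set0 = 0%N.
Proof. by have [B [_]] := rk_ex M set0; rewrite subset0 => /eqP -> <-; rewrite cards0. Qed.

Lemma indepE M J : (J \in indep M) = (rk M J == #|J|).
Proof.
apply/idP/eqP => [Ji|e].
  apply/eqP; rewrite eqn_leq rk_geq // andbT.
  by have [B [_ BJ <-]] := rk_ex M J; apply: subset_leq_card.
have [B [Bi BJ cB]] := rk_ex M J.
have -> // : J = B.
by apply/eqP; rewrite eq_sym eqEcard BJ cB e leqnn.
Qed.

Lemma matroid_rk_eq M1 M2 : ground M1 = ground M2 -> rk M1 =1 rk M2 -> M1 = M2.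
Proof.
by move=> eg er; apply: matroid_eq => //; apply/setP => J; rewrite !indepE er.
Qed.

Lemma rkIground M A : rk M (ground M :&: A) = rk M A.
Proof.
apply/eqP; rewrite eqn_leq rkS ?subsetIr //=.
have [B [Bi BA <-]] := rk_ex M A; apply: rk_geq => //.
by rewrite subsetI BA indep_ground.
Qed.

Lemma rk_restr M A B : rk (restr M A) B = rk M (A :&: B).
Proof.
by apply: eq_bigl => J; rewrite inE subsetI andbA.
Qed.

Lemma rk_contr M A B : (rk (contr M A) B + rk M A)%N = rk M (A :|: B).
Proof.
apply/eqP; rewrite eqn_leq; apply/andP; split.
  have [J [Ji JB <-]] := rk_ex (contr M A) B.
  move: Ji; rewrite inE => /andP [JE /exists_inP [D Di /and3P [DA /eqP <- JD]]].
  suff <- : #|J :|: D| = (#|J| + #|D|)%N.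
    by apply: rk_geq => //; rewrite setUC setUSS.
  apply/eqP; rewrite (leq_card_setU J D).2 -setI_eq0.
  apply/eqP/setP => x; rewrite !inE; apply/negP => /andP [xJ xD].
  by have := subsetP JE _ xJ; rewrite inE (subsetP DA).
have [D [Di DA cD]] := rk_ex M A.
have [C [Ci DC CAB cC]] := rk_ext Di (subset_trans DA (subsetUl A B)).
have CA : C :&: A = D.
  apply/eqP; rewrite eq_sym eqEcard subsetI DC DA cD rk_geq ?subsetIr //.
  by apply: indepS Ci; apply: subsetIl.
rewrite -cC -(cardsID A C) CA cD addnC leq_add2r; apply: rk_geq.
  rewrite inE setSD ?indep_ground //; apply/exists_inP; exists D => //.
  rewrite DA cD eqxx (indepS _ Ci) // subUset DC andbT; exact: subsetDl.
by apply/subsetP => x; rewrite inE => /andP [xA /(subsetP CAB)]; rewrite inE (negPf xA).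
Qed.

Lemma contr0 M : contr M set0 = M.
Proof.
apply: matroid_rk_eq => [|A]; first by rewrite /= setD0.
by have := rk_contr M set0 A; rewrite rk0 addn0 set0U.
Qed.

Lemma contr_contr M F G : F \subset G ->
  contr (contr M F) (G :\: F) = contr M G.
Proof.
move=> FG; have FGE : F :|: (G :\: F) = G.
  by rewrite -{2}(setID G F) (setIidPr FG).
apply: matroid_rk_eq => [|A].
  by rewrite /= setDDl FGE.
have := rk_contr (contr M F) (G :\: F) A.
have := rk_contr M F (G :\: F :|: A); have := rk_contr M F (G :\: F).
by rewrite setUA !FGE -(rk_contr M G A); lia.
Qed.

Lemma restr_contr M F G : F \subset G ->
  restr (contr M F) (G :\: F) = contr (restr M G) F.
Proof.
move=> FG; apply: matroid_rk_eq => [|A].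
  rewrite /=; apply/setP => x; rewrite !inE.
  by case: (x \in F) (x \in G) (x \in ground M) => [] [] [].
have := rk_contr M F ((G :\: F) :&: A); have := rk_contr (restr M G) F A.
rewrite !rk_restr (setIidPr FG).
suff -> : F :|: ((G :\: F) :&: A) = G :&: (F :|: A) by lia.
apply/setP => x; rewrite !inE; have := subsetP FG x.
by case: (x \in F) (x \in G) (x \in A) => [] [] [] // ->.
Qed.

Lemma flatP M F :
  reflect (F \subset ground M /\
           forall x, x \in ground M -> x \notin F -> (rk M F < rk M (x |: F))%N)
          (F \in flats M).
Proof.
rewrite inE; apply: (iffP andP) => -[-> h]; split=> //.
  move=> x xE xF; apply: (implyP (forallP h x)); by rewrite inE xF.
by apply/forall_inP => x; rewrite inE => /andP [xF xE]; apply: h.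
Qed.

Lemma flat_sub M F : F \in flats M -> F \subset ground M.
Proof. by case/flatP. Qed.

Lemma flat_ground M : ground M \in flats M.
Proof. by apply/flatP; split=> // x ->. Qed.

Lemma flat0 M : loopless M -> set0 \in flats M.
Proof.
move=> /forall_inP l; apply/flatP; split=> [|x xE _]; first exact: sub0set.
by rewrite rk0 setU0 (leq_trans _ (rk_geq (l _ xE) (subxx _))) // cards1.
Qed.

Lemma flat_rk_lt M F G : F \in flats M -> G \subset ground M -> F \proper G ->
  (rk M F < rk M G)%N.
Proof.
move=> /flatP [_ h] GE /properP [FG [x xG xF]].
apply: leq_trans (h x (subsetP GE _ xG) xF) _.
by apply: rkS; rewrite subUset sub1set xG.
Qed.

Lemma loopless_restr M A : loopless M -> loopless (restr M A).
Proof.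
move=> /forall_inP l; apply/forall_inP => x; rewrite /= inE => /andP [xE xA].
by rewrite inE l // sub1set.
Qed.

Lemma loopless_contr M F : F \in flats M -> loopless (contr M F).
Proof.
move=> /flatP [_ h]; apply/forall_inP => x; rewrite inE => /andP [xF xE].
have lt := h _ xE xF; rewrite indepE cards1 eqn_leq.
have [B [_ Bx cB]] := rk_ex (contr M F) [set x].
rewrite -{1}cB -(cards1 x) subset_leq_card //= cards1.
by have := rk_contr M F [set x]; rewrite setUC; lia.
Qed.

Lemma rk_closure M F H x : H \subset F ->
  (rk M F < rk M (x |: F))%N -> (rk M H < rk M (x |: H))%N.
Proof.
move=> HF lt; have [B [Bi BH cB]] := rk_ex M H.
have [B' [Bi' BB' BF' cB']] := rk_ext Bi (subset_trans BH HF).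
have [C [Ci B'C CF cC]] := rk_ext Bi' (subset_trans BF' (subsetUr [set x] F)).
have xC : x \in C.
  apply/negPn/negP => xC; suff : (#|C| <= rk M F)%N by lia.
  apply: rk_geq => //; apply/subsetP => y yC.
  have := subsetP CF _ yC; rewrite !inE => /orP [/eqP e|//].
  by rewrite -e yC in xC.
have xF : x \notin F.
  by apply/negP => xF; move: lt; rewrite (setUidPr _) ?ltnn // sub1set.
have xB : x \notin B by apply: contra xF => /(subsetP BH)/(subsetP HF).
have -> : rk M H = #|B| by [].
have -> : (#|B|).+1 = #|x |: B| by rewrite cardsU1 xB.
apply: rk_geq; last by rewrite setUS.
by apply: indepS Ci; rewrite subUset sub1set xC (subset_trans BB').
Qed.

Lemma flats_restr M F H : F \in flats M ->
  (H \in flats (restr M F)) = (H \in flats M) && (H \subset F).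
Proof.
move=> /flatP [FE hF]; apply/flatP/andP.
  rewrite /= subsetI => -[/andP [HE HF] h]; split=> //; apply/flatP; split=> // x xE xH.
  have [xF|xF] := boolP (x \in F); last by apply: rk_closure (hF _ xE xF).
  have := h x; rewrite inE xE xF => /(_ isT xH).
  by rewrite !rk_restr !(setIidPr _) // subUset sub1set xF.
case=> /flatP [HE h] HF; rewrite /= subsetI HE HF; split=> // x.
rewrite inE => /andP [xE xF] xH.
by rewrite !rk_restr !(setIidPr _) ?h // subUset sub1set xF.
Qed.

Lemma flats_contr M F H : F \subset ground M ->
  (H \in flats (contr M F)) = (H \subset ground M :\: F) && (F :|: H \in flats M).
Proof.
move=> FE; apply/flatP/andP => /=.
  case=> HE h; split=> //; apply/flatP; split.
    by rewrite subUset FE (subset_trans HE) // subsetDl.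
  move=> x xE; rewrite inE negb_or => /andP [xF xH].
  have := h x; rewrite inE xE xF => /(_ isT xH).
  by have := rk_contr M F H; have := rk_contr M F (x |: H); rewrite setUCA; lia.
case=> HE /flatP [_ h]; split=> // x; rewrite inE => /andP [xF xE] xH.
have := h x xE; rewrite inE negb_or xF xH => /(_ isT).
by have := rk_contr M F H; have := rk_contr M F (x |: H); rewrite setUCA; lia.
Qed.

End MatroidTheory.

Section Mobius.
Variable T : finType.
Implicit Types (S : {set {set T}}) (F G H K : {set T}).

(* The Möbius function of S ordered by inclusion; n bounds the recursion depth,
   see mobiusxx and mobius_proper. *)
Fixpoint mobius_rec (n : nat) S F G : int :=
  if n is n'.+1 then
    if F == G then 1 else
    if F \proper G then
      - \sum_(H in S | (F \subset H) && (H \proper G)) mobius_rec n' S F H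
    else 0
  else 0.

Definition mobius S F G : int := mobius_rec #|G|.+1 S F G.

Lemma mobiusxx S F : mobius S F F = 1.
Proof. by rewrite /mobius /= eqxx. Qed.

Lemma mobius_rec_stable n m S F G : (#|G| < n)%N -> (#|G| < m)%N ->
  mobius_rec n S F G = mobius_rec m S F G.
Proof.
elim: n m G => [|n IH] [|m] G // ltn ltm /=; case: eqP => // _; case: ifP => // _.
congr (- _); apply: eq_bigr => H /and3P [_ _ HG].
by apply: IH; apply: leq_trans (proper_card HG) _.
Qed.

Lemma mobius_proper S F G : F \proper G ->
  mobius S F G = - \sum_(H in S | (F \subset H) && (H \proper G)) mobius S F H.
Proof.
move=> FG; rewrite {1}/mobius /= FG; case: eqP => [e|_].
  by move: FG; rewrite e properxx.
congr (- _); apply: eq_bigr => H /and3P [_ _ HG].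
by apply: mobius_rec_stable => //; apply: proper_card.
Qed.

Lemma mobius_suml S F G : F \in S -> G \in S -> F \subset G ->
  \sum_(H in S | (F \subset H) && (H \subset G)) mobius S F H = (F == G)%:R.
Proof.
move=> FS GS FG; have [e|ne] := eqVneq F G.
  subst G; rewrite (bigD1 F) /=; last by rewrite FS subxx.
  rewrite mobiusxx big1 ?addr0 // => H /andP [/andP [_ HF] ne].
  by rewrite -eqEsubset eq_sym (negPf ne) in HF.
have pFG : F \proper G by rewrite properEneq ne.
rewrite (bigD1 G) /=; last by rewrite GS FG subxx.
rewrite mobius_proper // addrC; apply/eqP; rewrite subr_eq0; apply/eqP.
by apply: eq_bigl => H; rewrite properEneq -!andbA; congr [&& _, _ & _]; rewrite andbC.
Qed.

Lemma mobius_sumr S F G : F \in S -> G \in S -> F \subset G ->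
  \sum_(H in S | (F \subset H) && (H \subset G)) mobius S H G = (F == G)%:R.
Proof.
move=> FS GS; move: {2}(#|G| - #|F|)%N (leqnn (#|G| - #|F|)%N) => n.
elim: n F FS => [|n IH] F FS le FG.
  have e : F = G by apply/eqP; rewrite eqEcard FG; move: le; lia.
  rewrite e eqxx (bigD1 G) /=; last by rewrite GS subxx.
  rewrite mobiusxx big1 ?addr0 // => H /andP [/andP [_ HF] ne].
  by rewrite -eqEsubset eq_sym (negPf ne) in HF.
have [e|ne] := eqVneq F G.
  rewrite e (bigD1 G) /=; last by rewrite GS subxx.
  rewrite mobiusxx big1 ?addr0 // => H /andP [/andP [_ HF] nH].
  by rewrite -eqEsubset eq_sym (negPf nH) in HF.
pose nu K := \sum_(H in S | (K \subset H) && (H \subset G)) mobius S H G.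
have E : \sum_(K in S | (F \subset K) && (K \subset G)) mobius S F K * nu K = mobius S F G.
  under eq_bigr do rewrite mulr_sumr.
  rewrite (exchange_big_dep (fun H => (H \in S) && ((F \subset H) && (H \subset G)))) /=; last first.
    move=> K H /and3P [_ FK _] /and3P [-> KH ->].
    by rewrite (subset_trans FK KH).
  rewrite (eq_bigr (fun H => (F == H)%:R * mobius S H G)).
    rewrite (bigD1 F) /= ?FS ?subxx //= eqxx mul1r big1 ?addr0 // => H /andP [_ nH].
    by rewrite eq_sym (negPf nH) mul0r.
  move=> H /and3P [HS FH HG]; rewrite -mulr_suml -(@mobius_suml S) //; congr (_ * _).
  apply: eq_bigl => K; rewrite HS HG /= andbT -!andbA; congr (_ && _); congr (_ && _).
  by apply/andP/idP => [[]//|KH]; rewrite KH (subset_trans KH HG).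
have nuE K : K \in S -> F \proper K -> K \subset G -> nu K = (K == G)%:R.
  move=> KS FK KG; apply: IH => //.
  by have := proper_card FK; have := subset_leq_card KG; lia.
move: E; rewrite (bigD1 F) /= ?FS ?subxx ?FG // mobiusxx mul1r => E.
have : \sum_(i in S | (F \subset i) && (i \subset G) && (i != F)) mobius S F i * nu i = mobius S F G.
  rewrite (bigD1 G) /= ?GS ?FG ?subxx 1?eq_sym ?ne //=.
  rewrite nuE ?properEneq ?ne //= eqxx mulr1 big1 ?addr0 // => K.
  case/andP=> /and3P [KS /andP [FK KG] nK] nKG.
  by rewrite nuE ?(negPf nKG) ?mulr0 // properEneq eq_sym nK.
move=> E2; have eB : \sum_(i in S | (F \subset i) && (i \subset G) && (i != F)) mobius S F i * nu i =
  \sum_(i | (i \in S) && ((F \subset i) && (i \subset G)) && (i != F)) mobius S F i * nu i.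
  by apply: eq_bigl => K; rewrite -!andbA.
by move/eqP: E; rewrite -eB E2 -subr_eq0 addrK => /eqP.
Qed.

End Mobius.

Definition chi_poly (T : finType) (M : matroid T) : {poly int} :=
  \sum_(F in flats M) mobius (flats M) set0 F *: 'X^(rank M - rk M F).

(* t ^ r p(t ^ -1), for p of degree at most r *)
Definition revp (r : nat) (p : {poly int}) : {poly int} :=
  \sum_(i < r.+1) p`_i *: 'X^(r - i).

(* Matroids with loops are left unconstrained. *)
Definition is_KL (T : finType) (P : matroid T -> {poly int}) : Prop :=
  forall M : matroid T, loopless M ->
  [/\ rank M = 0%N -> P M = 1,
      (0 < rank M)%N -> (2 * (size (P M)).-1 < rank M)%N &
      revp (rank M) (P M) =
        \sum_(F in flats M) chi_poly (restr M F) * P (contr M F)].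

Section Revp.
Implicit Types (p q : {poly int}).

Lemma revpD r p q : revp r (p + q) = revp r p + revp r q.
Proof.
by rewrite /revp -big_split; apply: eq_bigr => i _; rewrite coefD scalerDl.
Qed.

Lemma revpZ r a p : revp r (a *: p) = a *: revp r p.
Proof.
by rewrite /revp scaler_sumr; apply: eq_bigr => i _; rewrite coefZ scalerA.
Qed.

Lemma revp0 r : revp r 0 = 0.
Proof. by rewrite /revp big1 // => i _; rewrite coef0 scale0r. Qed.

Lemma revpN r p : revp r (- p) = - revp r p.
Proof. by rewrite -scaleN1r revpZ scaleN1r. Qed.

Lemma revp_sum r (I : finType) (P : pred I) (f : I -> {poly int}) :
  revp r (\sum_(i | P i) f i) = \sum_(i | P i) revp r (f i).
Proof. exact: (big_morph (revp r) (revpD r) (revp0 r)). Qed.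

Lemma revpXn r n : (n <= r)%N -> revp r 'X^n = 'X^(r - n).
Proof.
move=> le; have lt : (n < r.+1)%N by [].
rewrite /revp (bigD1 (Ordinal lt)) //= coefXn eqxx scale1r big1 ?addr0 // => i ne.
rewrite coefXn; case: eqP => [e|]; last by rewrite scale0r.
by case/eqP: ne; apply: val_inj.
Qed.

Lemma coef_revp r p i : (i <= r)%N -> (revp r p)`_i = p`_(r - i).
Proof.
move=> le; have lt : (r - i < r.+1)%N by rewrite ltnS leq_subr.
rewrite /revp coef_sum (bigD1 (Ordinal lt)) //= coefZ coefXn subKn // eqxx mulr1.
rewrite big1 ?addr0 // => j ne; rewrite coefZ coefXn; case: eqP => [e|]; last by rewrite mulr0.
case/eqP: ne; apply: val_inj => /=; by have := ltn_ord j; lia.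
Qed.

Lemma size_revp r p : (size (revp r p) <= r.+1)%N.
Proof.
apply/leq_sizeP => j le; rewrite coef_sum big1 // => i _; rewrite coefZ coefXn.
by case: eqP => [e|]; rewrite ?mulr0 //; lia.
Qed.

Lemma poly_sum_Xn r p : (size p <= r.+1)%N -> p = \sum_(i < r.+1) p`_i *: 'X^i.
Proof.
move=> le; apply/polyP => i; rewrite -poly_def coef_poly; case: ltnP => // ge.
by rewrite nth_default // (leq_trans le).
Qed.

Lemma revpM a b p q : (size p <= a.+1)%N -> (size q <= b.+1)%N ->
  revp (a + b) (p * q) = revp a p * revp b q.
Proof.
move=> pa qb; rewrite {1}(poly_sum_Xn pa) {1}(poly_sum_Xn qb).
rewrite /(revp a p) /(revp b q) mulr_suml revp_sum [RHS]mulr_suml.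
apply: eq_bigr => i _; rewrite mulr_sumr revp_sum mulr_sumr; apply: eq_bigr => j _.
rewrite -scalerAl -scalerAr !revpZ -exprD revpXn; last by have := ltn_ord i; have := ltn_ord j; lia.
rewrite -scalerAl -scalerAr -exprD; congr (_ *: (_ *: 'X^ _)).
by have := ltn_ord i; have := ltn_ord j; lia.
Qed.

End Revp.

Section KLTheory.
Variable T : finType.
Implicit Types (M : matroid T) (F G H K : {set T}).

Lemma rank_restr M F : F \subset ground M -> rank (restr M F) = rk M F.
Proof. by move=> FE; rewrite /rank rk_restr /= setICA setIid (setIidPr FE). Qed.

Lemma rank_contr M F : F \subset ground M -> (rank (contr M F) + rk M F)%N = rank M.
Proof.
move=> FE; rewrite /rank rk_contr /=; congr (rk M _).
by rewrite -{2}(setID (ground M) F) (setIidPr FE).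
Qed.

Lemma setUDK F G : F \subset G -> F :|: (G :\: F) = G.
Proof. by move=> FG; rewrite -{2}(setID G F) (setIidPr FG). Qed.

Lemma sum_flats_contr (R : nmodType) M F (P : pred {set T}) (f : {set T} -> R) :
  F \in flats M ->
  \sum_(K in flats (contr M F) | P K) f K =
  \sum_(H in flats M | (F \subset H) && P (H :\: F)) f (H :\: F).
Proof.
move=> Ff; have FE := flat_sub Ff.
rewrite (reindex_onto (fun H => H :\: F) (fun K => F :|: K)) /=; last first.
  move=> K /andP []; rewrite flats_contr // => /andP [KE _] _.
  apply/setP => x; rewrite !inE; have := subsetP KE x; rewrite !inE.
  by case: (x \in F) (x \in K) => [] [] // /(_ isT).
apply: eq_bigl => H; rewrite flats_contr //.
have -> : (F :|: (H :\: F) == H) = (F \subset H).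
  apply/eqP/idP => [<-|]; [exact: subsetUl | exact: setUDK].
have [FH|] := boolP (F \subset H); last by rewrite !andbF.
rewrite setUDK //= andbT; have [Hf|] := boolP (H \in flats M); last by rewrite andbF.
by rewrite setSD ?flat_sub.
Qed.

Lemma mobius_contr M F G H : F \in flats M -> G \in flats M ->
  F \subset G -> H \in flats M -> F \subset H -> H \subset G ->
  mobius (flats (restr (contr M F) (G :\: F))) set0 (H :\: F) =
  mobius (flats M) F H.
Proof.
move=> Ff Gf FG; have FE := flat_sub Ff.
have Gf' : G :\: F \in flats (contr M F).
  by rewrite flats_contr // setUDK // Gf setSD ?flat_sub.
move: {2}#|H|.+1 (leqnn #|H|.+1) => n; elim: n H => // n IH H lt Hf FH HG.
have [e|ne] := eqVneq F H; first by rewrite -e setDv !mobiusxx.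
have pFH : F \proper H by rewrite properEneq ne.
rewrite mobius_proper; last first.
  by rewrite proper0 -subset0 subDset setU0; case/andP: pFH.
rewrite [RHS]mobius_proper //; congr (- _).
rewrite (eq_bigl (fun K => (K \in flats (contr M F)) && (K \proper H :\: F))).
  rewrite sum_flats_contr //; apply: eq_big => [K|K /and3P [Kf FK KH]].
    congr (_ && _); have [FK|//] := boolP (F \subset K); rewrite /=.
    by rewrite !properE !subDset !setUDK.
  have pKH : K \proper H.
    by move: KH; rewrite !properE !subDset !setUDK.
  apply: IH => //; first by apply: leq_trans (proper_card pKH) _.
  exact: subset_trans (proper_sub pKH) HG.
move=> K; rewrite flats_restr // sub0set /= -andbA; congr (_ && _).
apply/andP/idP => [[]//|KH]; rewrite KH; split=> //.
by apply: subset_trans (proper_sub KH) _; rewrite setSD.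
Qed.

Definition chi_int M F G : {poly int} :=
  \sum_(H in flats M | (F \subset H) && (H \subset G))
     mobius (flats M) F H *: 'X^(rk M G - rk M H).

Lemma chi_restr_contr M F G : F \in flats M -> G \in flats M -> F \subset G ->
  chi_poly (restr (contr M F) (G :\: F)) = chi_int M F G.
Proof.
move=> Ff Gf FG; have FE := flat_sub Ff.
have Gf' : G :\: F \in flats (contr M F).
  by rewrite flats_contr // setUDK // Gf setSD ?flat_sub.
rewrite /chi_poly (eq_bigl (fun K => (K \in flats (contr M F)) && (K \subset G :\: F))); last first.
  by move=> K; rewrite flats_restr.
rewrite sum_flats_contr //; apply: eq_big => [K|K /and3P [Kf FK KG]].
  have [FK|//] := boolP (F \subset K); by rewrite subDset setUDK.
have KG' : K \subset G by move: KG; rewrite subDset setUDK.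
rewrite mobius_contr //; congr (_ *: 'X^ _).
rewrite rank_restr ?flat_sub // rk_restr (setIidPr (setSD _ KG')).
have := rk_contr M F (K :\: F); have := rk_contr M F (G :\: F).
by rewrite !setUDK //; lia.
Qed.

Lemma chi_restr M G : loopless M -> G \in flats M ->
  chi_poly (restr M G) = chi_int M set0 G.
Proof.
move=> l Gf; have := chi_restr_contr (flat0 l) Gf (sub0set G).
by rewrite contr0 setD0.
Qed.

Lemma size_chi_int M F G : (size (chi_int M F G) <= (rk M G).+1)%N.
Proof.
rewrite /chi_int; apply: (leq_trans (size_sum _ _ _)); apply/bigmax_leqP => H _.
apply: leq_trans (size_scale_leq _ _) _; rewrite size_polyXn; lia.
Qed.

Lemma chi_int_kernel M G : loopless M -> G \in flats M -> G != set0 ->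
  \sum_(F in flats M | F \subset G)
     revp (rk M F) (chi_int M set0 F) * chi_int M F G = 0.
Proof.
move=> l Gf G0; have f0 := flat0 l.
pose mu := mobius (flats M).
have revE F : revp (rk M F) (chi_int M set0 F) =
    \sum_(H in flats M | H \subset F) mu set0 H *: 'X^(rk M H).
  rewrite /chi_int revp_sum; apply: eq_big => [H|H /and3P [Hf _ HF]].
    by rewrite sub0set.
  by rewrite revpZ revpXn ?leq_subr // subKn // rkS.
under eq_bigr do rewrite revE mulr_suml.
rewrite (exchange_big_dep (fun H => (H \in flats M) && (H \subset G))) /=; last first.
  by move=> F H /andP [_ FG] /andP [-> HF]; rewrite (subset_trans HF).
transitivity (\sum_(H in flats M | H \subset G) mu set0 H *: ('X^(rk M G) : {poly int})).
  apply: eq_bigr => H /andP [Hf HG].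
  rewrite (eq_bigl (fun F => (F \in flats M) && ((H \subset F) && (F \subset G)))); last first.
    by move=> F; rewrite Hf /= -andbA; congr (_ && _); rewrite andbC.
  rewrite -mulr_sumr -scalerAl; congr (_ *: _).
  rewrite /chi_int (exchange_big_dep (fun K => (K \in flats M) && ((H \subset K) && (K \subset G)))) /=; last first.
    by move=> F K /and3P [_ HF _] /and3P [-> FK ->]; rewrite (subset_trans HF).
  rewrite (eq_bigr (fun K => (H == K)%:R *: 'X^(rk M G - rk M K))).
    rewrite (bigD1 H) /= ?Hf ?subxx //= eqxx scale1r big1 ?addr0.
      by rewrite -exprD subnKC // rkS.
    by move=> K /andP [_ ne]; rewrite eq_sym (negPf ne) scale0r.
  move=> K /and3P [Kf HK KG]; rewrite -scaler_suml -(@mobius_sumr _ (flats M)) //; congr (_ *: _).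
  apply: eq_bigl => F; rewrite Kf KG /= andbT -!andbA; congr (_ && _); congr (_ && _).
  by apply/andP/idP => [[]//|FK]; rewrite FK (subset_trans FK).
rewrite -scaler_suml.
rewrite (_ : \sum_(_ in _ | _) _ = 0) ?scale0r //.
have := mobius_suml f0 Gf (sub0set G); rewrite eq_sym (negPf G0) => e; rewrite -[RHS]e.
by apply: eq_bigl => H; rewrite sub0set.
Qed.

Definition KL_rest (P : matroid T -> {poly int}) M : {poly int} :=
  \sum_(F in flats M | F != set0) chi_poly (restr M F) * P (contr M F).

Fixpoint KL_rec (n : nat) M : {poly int} :=
  if n is n'.+1 then
    if rank M == 0%N then 1 else
    \poly_(i < uphalf (rank M)) - (KL_rest (KL_rec n') M)`_i
  else 1.

Lemma rank_contr_lt M F : F \in flats M -> F != set0 -> loopless M ->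
  (rank (contr M F) < rank M)%N.
Proof.
move=> Ff F0 l; rewrite -(rank_contr (flat_sub Ff)).
have := flat_rk_lt (flat0 l) (flat_sub Ff); rewrite proper0 => /(_ F0).
by rewrite rk0; lia.
Qed.

Lemma KL_rec_stable n m M : loopless M -> (rank M <= n)%N -> (rank M <= m)%N ->
  KL_rec n M = KL_rec m M.
Proof.
elim: n m M => [|n IH] [|m] M l //=.
- by rewrite leqn0 => ->.
- by move=> _; rewrite leqn0 => ->.
move=> ln lm; case: eqP => // _.
have -> // : KL_rest (KL_rec n) M = KL_rest (KL_rec m) M.
apply: eq_bigr => F /andP [Ff F0]; congr (_ * _).
have lt := rank_contr_lt Ff F0 l.
apply: IH; first exact: loopless_contr.
  by rewrite -ltnS (leq_trans lt).
by rewrite -ltnS (leq_trans lt).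
Qed.

Lemma flats_rank0 M : loopless M -> rank M = 0%N ->
  forall F, (F \in flats M) = (F == set0).
Proof.
move=> l r0 F; apply/idP/eqP => [Ff|->]; last exact: flat0.
apply/eqP/negPn/negP => F0; have := rank_contr_lt Ff F0 l; by rewrite r0.
Qed.

Lemma chi_restr0 M : loopless M -> chi_poly (restr M set0) = 1.
Proof.
move=> l; rewrite chi_restr ?flat0 // /chi_int (bigD1 set0) /=; last by rewrite flat0 ?subxx.
rewrite mobiusxx subnn expr0 scale1r big1 ?addr0 // => H /andP [/and3P [_ _ H0]].
by rewrite -subset0 H0.
Qed.

Lemma KL_sumE P M : loopless M ->
  \sum_(F in flats M) chi_poly (restr M F) * P (contr M F) = P M + KL_rest P M.
Proof.
move=> l; rewrite (bigD1 set0) /=; last exact: flat0.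
by rewrite chi_restr0 // contr0 mul1r.
Qed.

Lemma size_chi_restr M F : loopless M -> F \in flats M ->
  (size (chi_poly (restr M F)) <= (rk M F).+1)%N.
Proof. by move=> l Ff; rewrite chi_restr // size_chi_int. Qed.

Lemma KL_rest_anti (P : matroid T -> {poly int}) M : loopless M ->
  (forall F, F \in flats M -> F != set0 ->
     (size (P (contr M F)) <= (rank (contr M F)).+1)%N /\
     revp (rank (contr M F)) (P (contr M F)) =
       \sum_(K in flats (contr M F)) chi_poly (restr (contr M F) K) * P (contr (contr M F) K)) ->
  revp (rank M) (KL_rest P M) = - KL_rest P M.
Proof.
move=> l hP; rewrite {1}/KL_rest revp_sum.
transitivity (\sum_(F in flats M | F != set0) \sum_(G in flats M | F \subset G)
   revp (rk M F) (chi_int M set0 F) * chi_int M F G * P (contr M G)).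
  apply: eq_bigr => F /andP [Ff F0]; have [sP eP] := hP F Ff F0.
  rewrite -(rank_contr (flat_sub Ff)) addnC revpM ?size_chi_restr //.
  rewrite eP chi_restr //.
  have := @sum_flats_contr _ M F predT
    (fun K => chi_poly (restr (contr M F) K) * P (contr (contr M F) K)) Ff.
  rewrite (eq_bigl (fun K => K \in flats (contr M F))); last by move=> K; rewrite andbT.
  move=> ->; rewrite mulr_sumr; apply: eq_big => [G|G /and3P [Gf FG _]].
    by rewrite andbT.
  by rewrite chi_restr_contr // contr_contr // mulrA.
rewrite (exchange_big_dep (fun G => (G \in flats M) && (G != set0))) /=; last first.
  move=> F G /andP [_ F0] /andP [-> FG] /=.
  by apply: contraNneq F0 => e; rewrite -subset0 -e.
rewrite /KL_rest -sumrN; apply: eq_bigr => G /andP [Gf G0].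
rewrite -mulr_suml -mulNr; congr (_ * _); rewrite chi_restr //.
have := chi_int_kernel l Gf G0; rewrite (bigD1 set0) /= ?flat0 ?sub0set //.
rewrite -{1}chi_restr ?flat0 // chi_restr0 // rk0.
rewrite -{1}(expr0 'X) revpXn // subnn expr0 mul1r addrC => /eqP.
rewrite addr_eq0 => /eqP <-; apply: eq_bigl => F.
by rewrite Gf /= -!andbA; congr (_ && _); rewrite andbC.
Qed.

Lemma KL_exists : {P : matroid T -> {poly int} | is_KL P}.
Proof.
pose P M := KL_rec (rank M) M; exists P => M.
move: {2}(rank M) (leqnn (rank M)) => n; elim: n M => [|n IH] M.
  rewrite leqn0 => /eqP r0 l; have PM : P M = 1 by rewrite /P r0.
  rewrite r0; split=> //.
  rewrite KL_sumE // PM /KL_rest big1 ?addr0; last first.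
    by move=> F; rewrite flats_rank0 // andbN.
  by rewrite -(expr0 'X) revpXn // subnn expr0.
move=> le l; have [r0|rp] : rank M = 0%N \/ (0 < rank M)%N by lia.
  by apply: IH => //; rewrite r0.
have PE : P M = \poly_(i < uphalf (rank M)) - (KL_rest P M)`_i.
  have e : rank M = (rank M).-1.+1 by lia.
  rewrite {1}/P {1}e [KL_rec _ M]/= gtn_eqF //.
  have -> // : KL_rest (KL_rec (rank M).-1) M = KL_rest P M.
  apply: eq_bigr => F /andP [Ff F0]; congr (_ * _).
  apply: KL_rec_stable => //; first exact: loopless_contr.
  by have := rank_contr_lt Ff F0 l; lia.
have sP : (2 * (size (P M)).-1 < rank M)%N.
  have : (size (P M) <= uphalf (rank M))%N by rewrite PE size_poly.
  by move: rp; lia.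
have hP F : F \in flats M -> F != set0 ->
     (size (P (contr M F)) <= (rank (contr M F)).+1)%N /\
     revp (rank (contr M F)) (P (contr M F)) =
       \sum_(K in flats (contr M F)) chi_poly (restr (contr M F) K) * P (contr (contr M F) K).
  move=> Ff F0; have lt := rank_contr_lt Ff F0 l.
  have [] := IH (contr M F); [lia|exact: loopless_contr|].
  move=> h0 h1 h2; split=> //; have [e|/h1] : rank (contr M F) = 0%N \/ (0 < rank (contr M F))%N by lia.
    by rewrite h0 // size_poly1.
  by lia.
have anti := KL_rest_anti l hP.
split=> //; first by move=> e; rewrite e in rp.
rewrite KL_sumE //; apply/polyP => i; rewrite coefD.
have sR : (size (KL_rest P M) <= (rank M).+1)%N.
  by rewrite -size_polyN -anti size_revp.
have [le_i|gt_i] := leqP i (rank M); last first.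
  have sP' : (size (P M) <= i)%N by move: sP; lia.
  rewrite (nth_default _ sP') !nth_default ?addr0 //.
    exact: leq_trans sR _.
  exact: leq_trans (size_revp _ _) _.
have /(congr1 (fun p : {poly int} => p`_i)) := anti; rewrite coef_revp // coefN => ai.
rewrite coef_revp // PE !coef_poly ai opprK.
have [h1|h1] := ltnP; have [h2|h2] := ltnP; rewrite ?add0r ?addNr //; first lia.
have e : (rank M - i)%N = i by lia.
by move/eqP: ai; rewrite e -addr_eq0 -mulr2n mulrn_eq0 => /eqP ->.
Qed.

Lemma KL_unique (P Q : matroid T -> {poly int}) : is_KL P -> is_KL Q ->
  forall M, loopless M -> P M = Q M.
Proof.
move=> hP hQ M; move: {2}(rank M) (leqnn (rank M)) => n; elim: n M => [|n IH] M.
  rewrite leqn0 => /eqP r0 l.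
  by have [-> // _ _] := hP M l; have [-> // _ _] := hQ M l.
move=> le l; have [r0|rp] : rank M = 0%N \/ (0 < rank M)%N by lia.
  by apply: IH => //; rewrite r0.
have [_ /(_ rp) sP eP] := hP M l; have [_ /(_ rp) sQ eQ] := hQ M l.
rewrite KL_sumE // in eP; rewrite KL_sumE // in eQ.
have eR : KL_rest P M = KL_rest Q M.
  apply: eq_bigr => F /andP [Ff F0]; congr (_ * _); apply: IH.
    by have := rank_contr_lt Ff F0 l; lia.
  exact: loopless_contr.
have e : revp (rank M) (P M - Q M) = P M - Q M.
  by rewrite revpD revpN eP eQ eR opprD addrACA subrr addr0.
apply/eqP; rewrite -subr_eq0; apply/eqP/polyP => i; rewrite coef0.
have small j : (rank M <= 2 * j)%N -> (P M - Q M)`_j = 0.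
  move=> h; rewrite coefB.
  have hp : (size (P M) <= j)%N by move: sP; lia.
  have hq : (size (Q M) <= j)%N by move: sQ; lia.
  by rewrite (nth_default _ hp) (nth_default _ hq) subr0.
have [h|h] := leqP (rank M) (2 * i); first exact: small.
rewrite -e coef_revp; last lia.
by apply: small; lia.
Qed.

End KLTheory.

(* Any two assignments satisfying is_KL agree on loopless matroids, see
   KL_unique. *)
Definition KL (T : finType) (M : matroid T) : {poly int} := sval (KL_exists T) M.

Lemma KL_is_KL (T : finType) : is_KL (@KL T).
Proof. exact: svalP (KL_exists T). Qed.

Definition Zpoly (T : finType) (M : matroid T) : {poly int} :=
  \sum_(F in flats M) 'X^(rk M F) * KL (contr M F).

Definition complex_root (R : realType) (p : {poly R}) (z : complex R) : bool :=
  root (map_poly (real_complex R) p) z.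

Definition real_rooted (R : realType) (p : {poly R}) : Prop :=
  forall z : complex R, complex_root p z -> complex.Im z = 0.

Definition has_nonreal_root (R : realType) (p : {poly R}) : Prop :=
  exists2 z : complex R, complex_root p z & complex.Im z != 0.

Definition KL_real_rooted_conjecture (R : realType) : Prop :=
  forall (T : finType) (M : matroid T), loopless M ->
    real_rooted (map_poly (intr : int -> R) (KL M)).

Definition Z_real_rooted_conjecture (R : realType) : Prop :=
  forall (T : finType) (M : matroid T), loopless M ->
    real_rooted (map_poly (intr : int -> R) (Zpoly M)).

Section ColumnMatroid.
Variables (F : fieldType) (m n : nat) (A : 'M[F]_(m, n)).

Lemma column_matroid_subproof :
  matroid_axiom [set: 'I_n] [set J : {set 'I_n} | free [seq col j A | j in J]].
Proof.
have size_cols (J : {set 'I_n}) : size [seq col j A | j in J] = #|J|.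
  by rewrite size_map cardE.
apply/matroid_axiomP; split.
- by rewrite inE /image_mem enum_set0 nil_free.
- by move=> J _; apply: subsetT.
- move=> J K; rewrite !inE => fJ KJ.
  have pJ : perm_eq (enum J) (enum K ++ enum (J :\: K)).
    apply: uniq_perm; rewrite ?enum_uniq ?cat_uniq ?enum_uniq //=.
      rewrite andbT; apply/hasPn => x; rewrite !mem_enum inE => /andP [xK _]; exact: xK.
    move=> x; rewrite mem_cat !mem_enum inE; have := subsetP KJ x.
    by case: (x \in K) => //= ->.
  move: fJ; rewrite (perm_free (perm_map _ pJ)) map_cat; exact: catl_free.
- move=> J K; rewrite !inE => fJ fK lt.
  have [x xK /andP [xJ xs]] : exists2 x, x \in K & (x \notin J) && (col x A \notin <<[seq col j A | j in J]>>%VS).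
    apply/exists_inP; apply: contraT; rewrite negb_exists => /forallP h.
    move: lt; rewrite ltnNge => /negP []; rewrite -!size_cols -(eqP fK) -(eqP fJ).
    apply: dimvS; apply/span_subvP => v /mapP [x]; rewrite mem_enum => xK ->.
    have := h x; rewrite xK /= negb_and !negbK => /orP [xJ|//].
    by apply: memv_span; apply: map_f; rewrite mem_enum.
  exists x; split=> //; rewrite inE.
  have pJ : perm_eq (enum (x |: J)) (x :: enum J).
    apply: uniq_perm; rewrite /= ?enum_uniq ?mem_enum ?xJ //.
    by move=> y; rewrite in_cons !mem_enum !inE.
  by rewrite (perm_free (perm_map _ pJ)) /= free_cons xs.
Qed.

(* Independence is linear independence of the family of columns, so repeated
   columns are parallel elements. *)
Definition column_matroid : matroid 'I_n := Matroid column_matroid_subproof.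

End ColumnMatroid.

Definition hamming_dist (F : fieldType) (n : nat) (u v : 'rV[F]_n) : nat :=
  #|[set i | u 0 i != v 0 i]|.

Definition has_min_dist (F : fieldType) (n : nat) (C : {vspace 'rV[F]_n}) (d : nat) : Prop :=
  (exists u v, [/\ u \in C, v \in C, u != v & hamming_dist u v = d]) /\
  (forall u v, u \in C -> v \in C -> u != v -> (d <= hamming_dist u v)%N).

Definition extended_golay_code (C : {vspace 'rV['F_2]_24}) : Prop :=
  \dim C = 12%N /\ has_min_dist C 8.

Definition generator_matrix (F : fieldType) (k n : nat)
    (C : {vspace 'rV[F]_n}) (G : 'M[F]_(k, n)) : Prop :=
  row_free G /\ forall u : 'rV[F]_n, (u \in C) = (u <= G)%MS.

(* Main.v *)
Require Import Defs.
From Stdlib Require Import ZArith.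
From mathcomp Require Import all_boot all_order all_algebra.
From mathcomp Require Import zify ring.
From mathcomp.zify Require Import ssrZ.
From mathcomp Require Import complex reals.

Set Implicit Arguments.
Unset Strict Implicit.
Unset Printing Implicit Defensive.
Import Order.TTheory GRing.Theory Num.Theory.
Local Open Scope ring_scope.

(** Laguerre's inequality: if all roots of a real polynomial p are real then
    p'(x)^2 - p(x) p''(x) >= 0 for every real x. For the Golay matroid,

      P = 1 + 3311 t + 162656 t^2 + 2419692 t^3 + 6722716 t^4 + 2923921 t^5

    violates it at x = -1/25, and Z, with coefficients 1, 3335, 205436, 4285820,
    31050690, 95326605, 137174576 and then symmetric, violates it at x = -26
    (laguerre_certificate). What remains is to prove that these are P and Z.

    The Z-polynomial is palindromic (revp_Zpoly), and P_M has degree below half the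
    rank; so P_M is what has to be added to the sum of t^(rk F) P_(M/F) over the
    nonempty flats F to make it palindromic. This recursion is linear, and can be
    summed over all flats of a given type, here the pair of rank and size. The summed
    recursion involves only the number of flats of one type inside a flat of another
    type, which depends on restrictions of M and not on its contractions (typZ_sum,
    typKL_table).

    The numbers come from the code. Spheres of radius 3 around the words of a
    punctured code fill the space, so that every five points lie on exactly one octad
    (octad_through). Counting octads through four points shows that octads meet
    evenly, and octads span the code; hence the code is doubly even and self-dual
    (octad_meet_even, code_doubly_even, golay_self_dual). By self-duality the
    circuits of the matroid are the minimal words, the nullity of a set is the
    dimension of the code of words inside it, and its corank is the dimension of the
    code of words outside it (card_inside_rk, card_inside_compl). This leaves 18
    types of flats (flat_type_in). As at most one octad fits into 11 points, the
    m-subsets of a flat with a given rank are counted by its size and its number of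
    octads; sorting them by their closures gives the number of flats of each type
    (count_dependent, count_independent, card_flats_of_type). A finite check then
    confirms the table of polynomials (golay_table_check).

    The conjectures fail because a Golay code exists: the binary cyclic code of
    length 23, extended by a parity bit (golay_code_exists). *)

(** * Z-polynomials and sums over flats of one type *)

Section ZPolynomial.
Variable T : finType.
Implicit Types (M : matroid T) (F G H K : {set T}).

(** Collecting the coefficient of one flat K leaves the sum of the Möbius function
    over the lower ends of the interval from F to K, which is 0 unless K = F. *)
Lemma sum_chi_int M F G : F \in flats M -> G \in flats M -> F \subset G ->
  \sum_(H in flats M | (F \subset H) && (H \subset G)) chi_int M H G =
  'X^(rk M G - rk M F).
Proof.
move=> Ff Gf FG; rewrite /chi_int.
rewrite (exchange_big_dep (fun K => (K \in flats M) && ((F \subset K) && (K \subset G)))) /=;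
  last first.
  by move=> H K /and3P [_ FH _] /and3P [-> HK ->]; rewrite (subset_trans FH HK).
rewrite (eq_bigr (fun K => (F == K)%:R *: 'X^(rk M G - rk M K))).
  rewrite (bigD1 F) /= ?Ff ?subxx ?FG //= eqxx scale1r big1 ?addr0 // => K /andP [_ ne].
  by rewrite eq_sym (negPf ne) scale0r.
move=> K /and3P [Kf FK KG]; rewrite -scaler_suml -(@mobius_sumr _ (flats M)) //; congr (_ *: _).
apply: eq_bigl => H; rewrite Kf KG /= andbT -!andbA.
have [HK|] := boolP (H \subset K); last by rewrite !andbF.
by rewrite (subset_trans HK KG).
Qed.

Lemma size_KL_contr M F : F \in flats M ->
  (size (KL (contr M F)) <= (rank (contr M F)).+1)%N.
Proof.
move=> Ff; have [h0 h1 _] := KL_is_KL (loopless_contr Ff).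
have [e|/h1] : rank (contr M F) = 0%N \/ (0 < rank (contr M F))%N by lia.
  by rewrite h0 // size_poly1.
by lia.
Qed.

Lemma revp_KL_contr M F : F \in flats M ->
  revp (rank (contr M F)) (KL (contr M F)) =
  \sum_(G in flats M | F \subset G) chi_int M F G * KL (contr M G).
Proof.
move=> Ff; have [_ _ ->] := KL_is_KL (loopless_contr Ff).
have := @sum_flats_contr _ _ M F predT
  (fun K => chi_poly (restr (contr M F) K) * KL (contr (contr M F) K)) Ff.
rewrite (eq_bigl (fun K => K \in flats (contr M F))); last by move=> K; rewrite andbT.
move=> ->; apply: eq_big => [G|G /and3P [Gf FG _]]; first by rewrite andbT.
by rewrite chi_restr_contr // contr_contr.
Qed.

(** The recursion expands the reversal of every P_(M/F) over the flats G above F; the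
    characteristic polynomials of the intervals below a fixed G sum to t^(rk G). *)
Lemma revp_Zpoly M : loopless M -> revp (rank M) (Zpoly M) = Zpoly M.
Proof.
move=> l; rewrite {1}/Zpoly revp_sum.
transitivity (\sum_(F in flats M) \sum_(G in flats M | F \subset G)
    chi_int M F G * KL (contr M G)).
  apply: eq_bigr => F Ff; rewrite -(rank_contr (flat_sub Ff)) addnC.
  rewrite revpM ?size_polyXn // ?size_KL_contr // revpXn // subnn expr0 mul1r.
  exact: revp_KL_contr.
rewrite (exchange_big_dep (fun G => G \in flats M)) /=; last by move=> F G _ /andP [].
apply: eq_bigr => G Gf; rewrite -mulr_suml; congr (_ * _).
have := sum_chi_int (flat0 l) Gf (sub0set G); rewrite rk0 subn0 => <-.
by apply: eq_bigl => F; rewrite sub0set Gf.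
Qed.

Lemma Zpoly_contr M F : F \in flats M ->
  Zpoly (contr M F) =
  \sum_(G in flats M | F \subset G) 'X^(rk M G - rk M F) * KL (contr M G).
Proof.
move=> Ff; rewrite /Zpoly.
have := @sum_flats_contr _ _ M F predT
  (fun K => 'X^(rk (contr M F) K) * KL (contr (contr M F) K)) Ff.
rewrite (eq_bigl (fun K => K \in flats (contr M F))); last by move=> K; rewrite andbT.
move=> ->; apply: eq_big => [G|G /and3P [Gf FG _]]; first by rewrite andbT.
rewrite contr_contr //; congr ('X^ _ * _).
by have := rk_contr M F (G :\: F); rewrite setUDK //; lia.
Qed.

End ZPolynomial.

Section FlatTypes.
Variables (T : finType) (M : matroid T) (I : eqType).
Variables (typ : {set T} -> I) (types : seq I) (rho : I -> nat) (N : I -> I -> int).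
Hypothesis types_uniq : uniq types.
Hypothesis typ_in : forall F, F \in flats M -> typ F \in types.
Hypothesis rk_typ : forall F, F \in flats M -> rk M F = rho (typ F).
Hypothesis card_typ : forall a G, a \in types -> G \in flats M ->
  #|[set F in flats M | (typ F == a) && (F \subset G)]|%:Z = N a (typ G).

(** Flats of one type may have different contractions; only the sum of their
    Kazhdan-Lusztig polynomials is determined by the numbers N. *)
Definition typKL a : {poly int} := \sum_(F in flats M | typ F == a) KL (contr M F).

Definition typZ a : {poly int} :=
  \sum_(b <- types) 'X^(rho b - rho a) * typKL b *~ N a b.

Lemma sum_by_typ (f : {set T} -> {poly int}) :
  \sum_(F in flats M) f F = \sum_(b <- types) \sum_(F in flats M | typ F == b) f F.
Proof.
rewrite (exchange_big_dep (mem (flats M))) //=; last by move=> b F _ /andP [].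
apply: eq_bigr => F Ff; rewrite Ff /= big_mkcond (bigD1_seq (typ F)) ?typ_in //= eqxx.
by rewrite big1 ?addr0 // => b; rewrite eq_sym => /negPf ->.
Qed.

(** A pair of flats F, G with F below G is charged to G: there are N a (typ G) such F
    of type a. *)
Lemma typZ_sum a : a \in types ->
  typZ a = \sum_(F in flats M | typ F == a) Zpoly (contr M F).
Proof.
move=> aT; apply: esym.
transitivity (\sum_(F in flats M | typ F == a) \sum_(G in flats M | F \subset G)
    'X^(rho (typ G) - rho a) * KL (contr M G)).
  apply: eq_bigr => F /andP [Ff /eqP eF]; rewrite Zpoly_contr //.
  by apply: eq_bigr => G /andP [Gf _]; rewrite !rk_typ // eF.
rewrite (exchange_big_dep (mem (flats M))) /=; last by move=> F G _ /andP [].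
transitivity (\sum_(G in flats M) ('X^(rho (typ G) - rho a) * KL (contr M G)) *~ N a (typ G)).
  apply: eq_bigr => G Gf; rewrite -card_typ // -pmulrn -sumr_const; apply: eq_bigl => F.
  by rewrite inE Gf /= andbA.
rewrite sum_by_typ; apply: eq_bigr => b _; rewrite /typKL mulr_sumr mulrz_suml.
by apply: eq_bigr => G /andP [_ /eqP ->].
Qed.

Lemma revp_typZ a : a \in types -> revp (rank M - rho a) (typZ a) = typZ a.
Proof.
move=> aT; rewrite typZ_sum // revp_sum; apply: eq_bigr => F /andP [Ff /eqP eF].
rewrite -{2}revp_Zpoly ?loopless_contr //; congr (revp _ _).
by rewrite -(rank_contr (flat_sub Ff)) rk_typ // eF addnK.
Qed.

Lemma coef_typKL_high a i : (0 < rank M - rho a)%N -> (rank M - rho a <= 2 * i)%N ->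
  (typKL a)`_i = 0.
Proof.
move=> pos hi; rewrite coef_sum big1 // => F /andP [Ff /eqP eF].
have e : (rank (contr M F) = rank M - rho a)%N.
  by rewrite -(rank_contr (flat_sub Ff)) rk_typ // eF addnK.
have [_ h1 _] := KL_is_KL (loopless_contr Ff).
rewrite nth_default //; move: h1; rewrite e => /(_ pos).
by move: hi; set s := size _; set d := (_ - _)%N; clear; lia.
Qed.

End FlatTypes.

(** * Laguerre's inequality *)

Section Laguerre.
Variable R : realType.
Implicit Types (p : {poly R}) (x : R).

Definition laguerre p x : R := p^`().[x] ^+ 2 - p.[x] * p^`()^`().[x].

(** The quotient of p'^2 - p p'' by p^2 is the sum of (x - r)^-2 over the roots r;
    the induction adds one root at a time and so avoids dividing by p. *)
Lemma laguerre_prod_ge0 (rs : seq R) x : 0 <= laguerre (\prod_(r <- rs) ('X - r%:P)) x.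
Proof.
elim: rs => [|r rs IH].
  by rewrite big_nil /laguerre -polyC1 !derivC !hornerE expr0n /= subr0.
rewrite big_cons; move: IH; rewrite /laguerre; set p := \prod_(_ <- _) _ => IH.
rewrite !(derivM, derivD, derivN, derivX, derivC, oppr0, addr0, mul1r, hornerE) /=.
set a := p.[x] in IH *; set b := p^`().[x] in IH *; set c := p^`()^`().[x] in IH *.
suff -> : (a + (x - r) * b) ^+ 2 - (x - r) * a * (b + b + (x - r) * c) =
    a ^+ 2 + (x - r) ^+ 2 * (b ^+ 2 - a * c).
  by rewrite addr_ge0 ?sqr_ge0 // mulr_ge0 ?sqr_ge0.
by ring.
Qed.

Lemma laguerreZ (k : R) p x : laguerre (k *: p) x = k ^+ 2 * laguerre p x.
Proof. by rewrite /laguerre !derivZ !hornerZ; ring. Qed.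

(** If every root of p in the algebraically closed field R[i] were real, p would be a
    product of real linear factors. *)
Lemma laguerre_nonreal_root p x : laguerre p x < 0 -> has_nonreal_root p.
Proof.
move=> neg; have p0 : p != 0.
  by apply: contraTneq neg => ->; rewrite /laguerre !(deriv0, hornerE) expr0n /= subr0 ltxx.
have [rs e] := closed_field_poly_normal (map_poly (real_complex R) p).
have [/allP allr|/allPn [z zrs nz]] := boolP (all (fun z => complex.Im z == 0) rs); last first.
  exists z => //; rewrite /complex_root e rootZ ?root_prod_XsubC //.
  by rewrite lead_coef_eq0 map_poly_eq0.
suff E : p = lead_coef p *: \prod_(r <- map (@complex.Re R) rs) ('X - r%:P).
  by move: neg; rewrite E laguerreZ ltNge mulr_ge0 ?sqr_ge0 ?laguerre_prod_ge0.
apply: (map_poly_inj (real_complex R)); rewrite {1}e map_polyZ /= lead_coef_map rmorph_prod.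
congr (_ *: _); rewrite big_map; apply: eq_big_seq => z /allr.
rewrite rmorphB /= map_polyX map_polyC.
by case: z => a b /= /eqP ->.
Qed.

Lemma nonreal_not_real_rooted p : has_nonreal_root p -> ~ real_rooted p.
Proof. by case=> z rz /eqP nz rr; apply: nz; apply: rr. Qed.

End Laguerre.

(** * Polynomials with binary integer coefficients *)

(** Coefficients are kept in Z, where arithmetic is binary and can be evaluated. *)
Fixpoint zpoly (s : seq Z) : {poly int} :=
  if s is c :: s' then zpoly s' * 'X + (int_of_Z c)%:P else 0.

Fixpoint add_coefs (s t : seq Z) : seq Z :=
  match s, t with
  | [::], _ => t
  | _, [::] => s
  | a :: s', b :: t' => (a + b) :: add_coefs s' t'
  end.

Definition scale_coefs (a : Z) (s : seq Z) : seq Z := [seq a * c | c <- s].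

(** The list of coefficients keeps its length, with a final 0. *)
Fixpoint deriv_coefs (s : seq Z) : seq Z :=
  if s is _ :: s' then add_coefs (0 :: deriv_coefs s') s' else [::].

(** The value at a / b, multiplied by b to the number of coefficients. *)
Fixpoint eval_coefs (s : seq Z) (a b : Z) : Z :=
  if s is c :: s' then eval_coefs s' a b * a + c * b ^+ (size s) else 0.

Lemma coef_zpoly s i : (zpoly s)`_i = int_of_Z (nth 0 s i).
Proof.
elim: s i => [|c s IH] [|i] /=; rewrite ?coef0 //.
  by rewrite coefD coefMX coefC add0r.
by rewrite coefD coefMX coefC addr0 IH.
Qed.

Lemma zpolyD s t : zpoly (add_coefs s t) = zpoly s + zpoly t.
Proof.
elim: s t => [|a s IH] [|b t] /=; rewrite ?add0r ?addr0 // IH rmorphD polyCD.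
by ring.
Qed.

Lemma zpolyZ a s : zpoly (scale_coefs a s) = zpoly s *~ int_of_Z a.
Proof.
have e : (int_of_Z a)%:P = (int_of_Z a)%:~R :> {poly int}.
  by rewrite -[in LHS](intz (int_of_Z a)) rmorph_int.
elim: s => [|c s IH] /=; first by rewrite mul0rz.
rewrite -/(scale_coefs a s) IH rmorphM polyCM e -[RHS]mulrzl -[zpoly s *~ _]mulrzl.
by rewrite mulrDr mulrA.
Qed.

Lemma zpoly_shift k s : zpoly (ncons k 0 s) = 'X^k * zpoly s.
Proof.
elim: k => [|k IH] /=; first by rewrite expr0 mul1r.
by rewrite IH polyC0 addr0 exprSr; ring.
Qed.

Lemma deriv_zpoly s : (zpoly s)^`() = zpoly (deriv_coefs s).
Proof.
elim: s => [|c s IH]; first by rewrite /= deriv0.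
rewrite -[deriv_coefs _]/(add_coefs (0 :: deriv_coefs s) s) zpolyD /=.
by rewrite derivD derivM derivX derivC IH polyC0 !addr0 mulr1.
Qed.

Lemma revp_zpoly d s : size s = d.+1 -> revp d (zpoly s) = zpoly (rev s).
Proof.
move=> sz; apply/polyP => i; have [le|gt] := leqP i d.
  by rewrite coef_revp // !coef_zpoly nth_rev sz ?ltnS // subSS.
rewrite nth_default; last by rewrite (leq_trans (size_revp _ _)).
by rewrite coef_zpoly nth_default // size_rev sz.
Qed.

Lemma int_of_Z_lt0 z : Z.ltb z 0 -> int_of_Z z < 0.
Proof. by case: z. Qed.

Section Evaluation.
Variable R : realType.
Implicit Types (s : seq Z) (a b : Z).

Let toR (z : Z) : R := (int_of_Z z)%:~R.

Let toRD : {morph toR : x y / x + y}. Proof. by move=> x y; rewrite /toR !rmorphD. Qed.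
Let toRB : {morph toR : x y / x - y}. Proof. by move=> x y; rewrite /toR !rmorphB. Qed.
Let toRM : {morph toR : x y / x * y}. Proof. by move=> x y; rewrite /toR !rmorphM. Qed.
Let toRX n : {morph toR : x / x ^+ n}. Proof. by move=> x; rewrite /toR !rmorphXn. Qed.

Lemma toR_eval s a b : toR b != 0 ->
  toR (eval_coefs s a b) =
  toR b ^+ size s * (map_poly (intr : int -> R) (zpoly s)).[toR a / toR b].
Proof.
move=> b0; elim: s => [|c s IH]; first by rewrite /= rmorph0 horner0 mulr0 /toR rmorph0.
rewrite /= toRD !toRM IH toRX rmorphD rmorphM /= map_polyX map_polyC !hornerE /= exprS.
rewrite /toR; field; exact: b0.
Qed.

(** The integer compared with 0 is the Laguerre expression at a / b times a power of b;
    the condition on the sizes says that both of its terms carry the same power. *)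
Lemma laguerre_certificate s a b : (0 < int_of_Z b) ->
  let s' := deriv_coefs s in let s'' := deriv_coefs s' in
  (size s' + size s' == size s + size s'')%N ->
  Z.ltb (eval_coefs s' a b ^+ 2 - eval_coefs s a b * eval_coefs s'' a b)%R 0 ->
  has_nonreal_root (map_poly (intr : int -> R) (zpoly s)).
Proof.
move=> b0 s' s'' /eqP sz neg.
have b0' : 0 < toR b by rewrite /toR ltr0z.
have bn : toR b != 0 by rewrite gt_eqF.
apply: (@laguerre_nonreal_root _ _ (toR a / toR b)).
rewrite /laguerre !deriv_map !deriv_zpoly -/s' -/s''.
rewrite -(pmulr_rlt0 _ (exprn_gt0 (size s' + size s') b0')).
have : toR (eval_coefs s' a b ^+ 2 - eval_coefs s a b * eval_coefs s'' a b) < 0.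
  by rewrite /toR ltrz0; apply: int_of_Z_lt0 neg.
rewrite toRB toRX (toRM (eval_coefs s a b)) !toR_eval // mulrACA -exprD -sz exprD.
by congr (_ < 0); ring.
Qed.
End Evaluation.

(** * Certified tables of Kazhdan-Lusztig polynomials *)

(** The upper half of p vanishes, and the symmetry maps the lower half into it. *)
Lemma revp_fixed_small d (p : {poly int}) : revp d p = p -> (0 < d)%N ->
  (forall i, (d <= 2 * i)%N -> p`_i = 0) -> p = 0.
Proof.
move=> sym pos small; apply/polyP => i; rewrite coef0.
have [h|h] := leqP d (2 * i); first exact: small.
by rewrite -sym coef_revp; [apply: small; lia | lia].
Qed.

Section TableCheck.
Variables (I : eqType) (types : seq I) (rho : I -> nat) (N : I -> I -> Z).
Variables (n : nat) (tab : I -> seq Z).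

(** The polynomial typZ a as computed from the table. *)
Definition Z_coefs a : seq Z :=
  foldr add_coefs [::]
    [seq ncons (rho b - rho a) 0 (scale_coefs (N a b) (tab b))
    | b <- types & N a b != 0].

(** N is unitriangular with respect to the rank, and each entry below the top has a
    degree small enough and makes Z_coefs palindromic. *)
Definition table_check : bool :=
  all (fun a =>
    [&& rho a <= n, N a a == 1%R,
        all (fun b => (rho b <= rho a)%N ==> (b != a) ==> (N a b == 0%R)) types &
        if (rho a < n)%N then
          [&& size (tab a) <= uphalf (n - rho a), size (Z_coefs a) == (n - rho a).+1 &
              rev (Z_coefs a) == Z_coefs a]
        else tab a == [:: 1%R]])%N types.

Lemma zpoly_Z_coefs a :
  zpoly (Z_coefs a) =
  \sum_(b <- types) 'X^(rho b - rho a) * zpoly (tab b) *~ int_of_Z (N a b).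
Proof.
rewrite /Z_coefs; elim: types => [|b s IH]; first by rewrite big_nil.
rewrite big_cons -IH /=; case: eqP => [->|_] /=; first by rewrite mulr0z add0r.
by rewrite zpolyD zpoly_shift zpolyZ mulrzAr.
Qed.

Variables (T : finType) (M : matroid T) (typ : {set T} -> I).
Hypothesis rankM : rank M = n.
Hypothesis types_uniq : uniq types.
Hypothesis typ_in : forall F, F \in flats M -> typ F \in types.
Hypothesis rk_typ : forall F, F \in flats M -> rk M F = rho (typ F).
Hypothesis card_typ : forall a G, a \in types -> G \in flats M ->
  #|[set F in flats M | (typ F == a) && (F \subset G)]|%:Z = int_of_Z (N a (typ G)).
Hypothesis card_top : forall a, a \in types -> rho a = n ->
  typKL M typ a = 1.

(** Descending induction on the rank. Once the larger ranks agree, the difference of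
    the two sides at a is the difference of two palindromic polynomials, while both
    sides have low degree; so it is 0. *)
Theorem typKL_table a : table_check -> a \in types -> typKL M typ a = zpoly (tab a).
Proof.
move=> /allP chk; have [k] := ubnP (n - rho a); elim: k a => // k IH a lt aT.
have /and4P [le /eqP Naa /allP Nlow top] := chk a aT.
case: (ltnP (rho a) n) top => [lta /and3P [small /eqP sz /eqP pal]|gea /eqP ->]; last first.
  rewrite card_top //; last by apply/eqP; rewrite eqn_leq le.
  by rewrite /= mul0r add0r.
apply/eqP; rewrite -subr_eq0; apply/eqP/(@revp_fixed_small (n - rho a)).
- have E : typKL M typ a - zpoly (tab a) =
      typZ M typ types rho (fun a b => int_of_Z (N a b)) a - zpoly (Z_coefs a).
    rewrite zpoly_Z_coefs /typZ -sumrB (bigD1_seq a) //= subnn expr0 !mul1r Naa !mulr1z.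
    rewrite big1_seq ?addr0 // => b /andP [ba bT]; have := Nlow b bT; rewrite ba /=.
    case: leqP => [_ /eqP ->|gt _]; first by rewrite !mulr0z subr0.
    rewrite IH ?subrr //; move: lt gt lta; clear; lia.
  rewrite E revpD revpN -{1}rankM (revp_typZ types_uniq typ_in rk_typ card_typ aT).
  by rewrite revp_zpoly // pal.
- by rewrite subn_gt0.
move=> i hi; have pos : (0 < n - rho a)%N by rewrite subn_gt0.
have sm : (size (tab a) <= i)%N.
  by move: small hi; move: (size _) (n - _)%N => x y; clear; lia.
rewrite coefB (coef_typKL_high rk_typ) ?rankM //.
by rewrite coef_zpoly nth_default // rmorph0 subr0.
Qed.

End TableCheck.

(** * Binary linear codes as set systems *)

Local Open Scope nat_scope.

Definition symdiff {T : finType} (A B : {set T}) := [set x | (x \in A) (+) (x \in B)].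
Local Notation "A :+: B" := (symdiff A B) (at level 52, left associativity).

Section BinaryCodes.
Variable T : finType.
Implicit Types (A B J X : {set T}) (C : {set {set T}}).

Lemma symdiffC A B : A :+: B = B :+: A.
Proof. by apply/setP => x; rewrite !inE addbC. Qed.

Lemma symdiffK A B : A :+: B :+: B = A.
Proof. by apply/setP => x; rewrite !inE addbK. Qed.

Lemma symdiffKl A : cancel (symdiff A) (symdiff A).
Proof. by move=> B; rewrite symdiffC (symdiffC A) symdiffK. Qed.

Lemma symdiffE A B : A :+: B = (A :\: B) :|: (B :\: A).
Proof. by apply/setP => x; rewrite !inE; case: (x \in A); case: (x \in B). Qed.

Lemma symdiff_eq0 A B : A :+: B = set0 -> A = B.
Proof.
by move=> e; rewrite -(symdiffK A B) e; apply/setP => x; rewrite !inE.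
Qed.

Lemma card_symdiff A B : #|A :+: B| + 2 * #|A :&: B| = #|A| + #|B|.
Proof.
have := cardsUI (A :\: B) (B :\: A); rewrite -symdiffE.
have -> : (A :\: B) :&: (B :\: A) = set0.
  by apply/setP => x; rewrite !inE; case: (x \in A); case: (x \in B).
have := cardsID B A; have := cardsID A B.
by rewrite cards0 (setIC B A); lia.
Qed.

Lemma odd_symdiffI A B X :
  odd #|(A :+: B) :&: X| = odd #|A :&: X| (+) odd #|B :&: X|.
Proof.
have -> : (A :+: B) :&: X = (A :&: X) :+: (B :&: X).
  by apply/setP => x; rewrite !inE; case: (x \in X); rewrite ?andbT ?andbF.
have := card_symdiff (A :&: X) (B :&: X) => /(congr1 odd).
by rewrite mul2n !oddD odd_double addbF.
Qed.

(** A word of a binary code is encoded by its support. *)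
Definition linear_code C := set0 \in C /\ {in C &, forall A B, A :+: B \in C}.

Definition dual_code C := [set X | [forall A in C, ~~ odd #|A :&: X|]].

Definition inside C J := [set A in C | A \subset J].

Lemma linear_powerset J : linear_code (powerset J).
Proof.
split=> [|A B]; rewrite !inE ?sub0set // => AJ BJ.
by rewrite symdiffE subUset !(subset_trans (subsetDl _ _)).
Qed.

(** Adding a word that meets X in an odd number of points flips every sign. *)
Lemma sum_characters C X : linear_code C ->
  (\sum_(A in C) (-1) ^+ #|A :&: X| = (if X \in dual_code C then #|C|%:R else 0) :> int)%R.
Proof.
case=> C0 CD; rewrite inE; case: ifP => [/forall_inP ev|/negbT].
  rewrite (eq_bigr (fun=> 1%R)) ?sumr_const // => A /ev.
  by rewrite -signr_odd => /negPf ->.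
rewrite negb_forall => /existsP [D]; rewrite negb_imply negbK => /andP [DC oD].
set S := (\sum_(_ in _) _)%R; suff : (S = - S)%R by lia.
rewrite {1}/S (reindex_onto (symdiff^~ D) (symdiff^~ D)) /=; last first.
  by move=> A _; rewrite symdiffK.
rewrite /S -sumrN; apply: eq_big => [A|A _].
  rewrite symdiffK eqxx andbT; apply/idP/idP => AC; last exact: CD.
  by rewrite -(symdiffK A D) CD.
by rewrite -signr_odd odd_symdiffI oD addbT -[in RHS]signr_odd; case: (odd _).
Qed.

(** Both sides are the sum of (-1)^|A :&: X| over A in C and X inside J, with the two
    summations taken in either order. *)
Lemma card_inside_dual C J : linear_code C ->
  #|inside C (~: J)| * 2 ^ #|J| = #|inside (dual_code C) J| * #|C|.
Proof.
move=> lC; apply/eqP; rewrite -(eqr_nat int); apply/eqP.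
transitivity (\sum_(X in powerset J) \sum_(A in C) (-1) ^+ #|A :&: X| : int)%R.
  rewrite exchange_big /= natrM.
  rewrite -sumr_const [RHS](bigID (fun A => A \subset ~: J)) /= [X in _ = (_ + X)%R]big1 ?addr0.
    rewrite mulr_suml; apply: eq_big => [A|A]; first by rewrite inE.
    rewrite inE => /andP [_ AJ]; rewrite mul1r -card_powerset.
    rewrite (eq_bigr (fun=> 1%R)) ?sumr_const // => X; rewrite inE => XJ.
    suff -> : A :&: X = set0 by rewrite cards0.
    apply/setP => x; rewrite !inE; apply/negP => /andP [xA xX].
    by have := subsetP AJ _ xA; rewrite inE (subsetP XJ).
  move=> A /andP [_ /subsetPn [x xA]]; rewrite inE negbK => xJ.
  under eq_bigr do rewrite setIC.
  rewrite (sum_characters A (linear_powerset J)) inE ifF //.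
  apply/negP => /forall_inP /(_ [set x]); rewrite inE sub1set xJ => /(_ isT).
  suff -> : [set x] :&: A = [set x] by rewrite cards1.
  by apply/setIidPl; rewrite sub1set.
under eq_bigr do rewrite (sum_characters _ lC).
rewrite -big_mkcondr /= sumr_const -mulrnA mulnC; congr (_ *+ (_ * _))%R.
apply: eq_card => X; rewrite -[LHS]/((X \in powerset J) && (X \in dual_code C)).
by rewrite powersetE [RHS]inE andbC.
Qed.

Lemma inside_set0 C : linear_code C -> inside C set0 = [set set0].
Proof.
case=> C0 _; apply/setP => A; rewrite !inE subset0 andbC.
by case: eqP => // ->.
Qed.

Lemma inside_setT C : inside C setT = C.
Proof. by apply/setP => A; rewrite inE subsetT andbT. Qed.

(** The dual code of C has 2^|T| / |C| words, by the duality formula for J = T. *)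
Lemma self_dual C : linear_code C -> C \subset dual_code C ->
  #|C| * #|C| = 2 ^ #|T| -> dual_code C = C.
Proof.
move=> lC sub sq; apply/esym/eqP; rewrite eqEcard sub /=.
have := card_inside_dual setT lC.
rewrite setCT inside_set0 // cards1 mul1n cardsT -sq inside_setT => e.
have pos : 0 < #|C| by apply/card_gt0P; exists set0; case: lC.
by rewrite -(leq_pmul2r pos) e.
Qed.

(** Adding A exchanges the words inside J that contain x with those that avoid x. *)
Lemma card_inside_setD1 C J x A : linear_code C ->
  A \in inside C J -> x \in A -> #|inside C J| = 2 * #|inside C (J :\ x)|.
Proof.
move=> [C0 CD]; rewrite inE => /andP [AC AJ] xA.
have xJ : x \in J by apply: (subsetP AJ).
rewrite -(cardsID [set B : {set T} | x \in B]) mul2n -addnn; congr (_ + _); last first.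
  apply: eq_card => B; rewrite !inE subsetD1 andbC.
  by case: (B \in C); case: (B \subset J); rewrite ?andbF.
rewrite -(card_imset (f := symdiff A) (inside C (J :\ x)) (can_inj (symdiffKl A))).
apply: eq_card => B; rewrite in_setI; apply/idP/imsetP.
  rewrite !inE => /andP [/andP [BC BJ] xB]; exists (B :+: A); last by rewrite symdiffC symdiffK.
  rewrite inE CD // subsetD1 symdiffE subUset !(subset_trans (subsetDl _ _)) //=.
  by rewrite !inE xB xA.
case=> D /setIdP [DC]; rewrite subsetD1 => /andP [DJ xD] ->.
rewrite !inE CD // xA (negPf xD) /= symdiffE subUset.
by rewrite !(subset_trans (subsetDl _ _)).
Qed.

End BinaryCodes.

(** * The matroid of a self-dual binary code *)

Section CodeMatroid.
Variables (T : finType) (M : matroid T) (C : {set {set T}}).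
Hypothesis linC : linear_code C.
Hypothesis indepC : forall J, (J \in indep M) = (#|inside C J| == 1).
Implicit Types (A B J F : {set T}).

Lemma dependentP J : J \notin indep M -> exists2 A, A \in inside C J & A != set0.
Proof.
have [C0 _] := linC; have J0 : set0 \in inside C J by rewrite inE C0 sub0set.
move=> dJ; have : (inside C J :\ set0) != set0.
  apply: contraNneq dJ => e; by rewrite indepC (cardsD1 set0) J0 e cards0.
by case/set0Pn => A; rewrite 2!inE => /andP [A0 AJ]; exists A.
Qed.

Lemma indep_inside J A : J \in indep M -> A \in C -> A \subset J -> A = set0.
Proof.
have [C0 _] := linC; rewrite indepC => /cards1P [D eD] AC AJ.
have : A \in inside C J by rewrite inE AC.
have : set0 \in inside C J by rewrite inE C0 sub0set.
by rewrite eD => /set1P <- /set1P.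
Qed.

(** Grow a basis of J point by point: each new point closes a fundamental circuit,
    which doubles the number of words. *)
Lemma card_inside_rk J : #|inside C J| * 2 ^ rk M J = 2 ^ #|J|.
Proof.
have [B [Bi BJ cB]] := rk_ex M J.
suff H n K : #|K :\: B| = n -> B \subset K -> K \subset J -> #|inside C K| = 2 ^ n.
  by rewrite (H _ J erefl) // -expnD -cB -(cardsID B J) (setIidPr BJ) addnC.
elim: n K => [|n IH] K eK BK KJ.
  have -> : K = B.
    by apply/eqP; rewrite eqEsubset BK andbT -setD_eq0 -cards_eq0 eK.
  by apply/eqP; rewrite -indepC.
have /set0Pn [y] : K :\: B != set0 by rewrite -cards_eq0 eK.
rewrite inE => /andP [yB yK].
have : y |: B \notin indep M.
  apply/negP => yBi; have : #|y |: B| <= rk M J.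
    by apply: rk_geq => //; rewrite subUset sub1set (subsetP KJ) // BJ.
  by rewrite cardsU1 yB -cB ltnn.
case/dependentP => A; rewrite inE => /andP [AC AyB] A0.
have yA : y \in A.
  apply: contraNT A0 => yA; apply/eqP/(indep_inside Bi) => //.
  apply/subsetP => x xA; have := subsetP AyB _ xA; rewrite !inE => /orP [/eqP e|//].
  by rewrite e (negPf yA) in xA.
have AK : A \in inside C K.
  by rewrite inE AC (subset_trans AyB) // subUset sub1set yK.
rewrite (card_inside_setD1 linC AK yA) expnS (IH (K :\ y)) //.
- have := cardsD1 y (K :\: B); rewrite !inE yB yK eK /=.
  suff -> : (K :\: B) :\ y = K :\ y :\: B by lia.
  by apply/setP => x; rewrite !inE andbCA.
- by rewrite subsetD1 BK.
- by rewrite (subset_trans _ KJ) // subsetDl.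
Qed.

Hypothesis self_dualC : dual_code C = C.

Lemma card_inside_compl J : #|inside C (~: J)| * 2 ^ rk M J = #|C|.
Proof.
have := card_inside_dual J linC; rewrite self_dualC.
have := card_inside_rk J; move: (rk M J) => r e1 e2.
apply/eqP; rewrite -(eqn_pmul2r (expn_gt0 2 #|J|)) /=.
by rewrite -mulnAC e2 mulnAC e1 mulnC.
Qed.

End CodeMatroid.

(** * Closures and counting subsets *)

Section Closure.
Variables (T : finType) (M : matroid T).
Implicit Types (F H X : {set T}).

Definition closure X := [set x in ground M | rk M (x |: X) == rk M X].

Lemma sub_closure X : X \subset ground M -> X \subset closure X.
Proof.
move=> XE; apply/subsetP => x xX; rewrite inE (subsetP XE) //=.
by rewrite (setUidPr _) ?eqxx // sub1set.
Qed.

Lemma rk_closureE X : X \subset ground M -> rk M (closure X) = rk M X.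
Proof.
move=> XE; apply/eqP; rewrite eqn_leq (rkS _ (sub_closure XE)) andbT.
have [B [Bi BX cB]] := rk_ex M X.
have [B' [Bi' BB' B'c cB']] := rk_ext Bi (subset_trans BX (sub_closure XE)).
rewrite -cB -cB' leqNgt; apply/negP => lt.
have /properP [_ [x xB' xB]] : B \proper B' by rewrite properEcard BB'.
have := subsetP B'c _ xB'; rewrite inE => /andP [_ /eqP e].
have : #|x |: B| <= rk M (x |: X).
  apply: rk_geq; last exact: setUS.
  by apply: indepS Bi'; rewrite subUset sub1set xB'.
by rewrite e cardsU1 xB -cB ltnn.
Qed.

Lemma closure_flat X : X \subset ground M -> closure X \in flats M.
Proof.
move=> XE; apply/flatP; split=> [|x xE]; first by apply/subsetP => x; rewrite inE => /andP [].
rewrite inE xE /= => ne; rewrite rk_closureE //.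
apply: (@leq_trans (rk M (x |: X))); last by apply: rkS; rewrite setUS // sub_closure.
by rewrite ltn_neqAle eq_sym ne rkS // subsetUr.
Qed.

Lemma closure_min X F : F \in flats M -> X \subset F -> closure X \subset F.
Proof.
move=> /flatP [_ h] XF; apply/subsetP => x; rewrite inE => /andP [xE /eqP e].
apply/negPn/negP => xF; have := rk_closure XF (h _ xE xF).
by rewrite e ltnn.
Qed.

Lemma flat_eq_rk F H : F \in flats M -> H \in flats M -> F \subset H ->
  rk M H <= rk M F -> F = H.
Proof.
move=> Ff Hf FH; apply: contraTeq => ne; rewrite -ltnNge.
by apply: flat_rk_lt => //; [apply: flat_sub | rewrite properEneq ne].
Qed.

Definition rank_subsets m r H :=
  [set X : {set T} | [&& X \subset H, #|X| == m & rk M X == r]].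

(** A set of rank r lies in exactly one flat of rank r, its closure. *)
Lemma card_rank_subsets m r H : H \in flats M ->
  #|rank_subsets m r H| =
  \sum_(F in flats M | (rk M F == r) && (F \subset H)) #|rank_subsets m r F|.
Proof.
move=> Hf; under eq_bigr do rewrite -sum1_card.
rewrite (exchange_big_dep (mem (rank_subsets m r H))) /=; last first.
  move=> F X /and3P [_ _ FH]; rewrite !inE => /and3P [XF -> ->].
  by rewrite (subset_trans XF FH).
rewrite -sum1_card; apply: eq_bigr => X; rewrite inE => /and3P [XH cX /eqP rX].
have XE := subset_trans XH (flat_sub Hf).
rewrite (big_pred1 (closure X)) // => F /=; rewrite !inE cX rX eqxx !andbT.
apply/idP/eqP => [/andP [/and3P [Ff /eqP rF FH] XF]|->].
  have F' : F \in flats M by rewrite inE.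
  apply/esym/flat_eq_rk; rewrite ?closure_flat ?closure_min //.
  by rewrite rk_closureE // rX rF.
by rewrite rk_closureE // rX eqxx sub_closure // closure_min // -[flat _ _]in_set closure_flat.
Qed.

End Closure.

Lemma card_supersets (T : finType) (A H : {set T}) m : A \subset H -> #|A| <= m ->
  #|[set X : {set T} | [&& A \subset X, X \subset H & #|X| == m]]| = 'C(#|H| - #|A|, m - #|A|).
Proof.
move=> AH le; have cHA : #|H :\: A| = #|H| - #|A| by rewrite cardsD (setIidPr AH).
have UK (Z : {set T}) : Z \subset H :\: A -> (A :|: Z) :\: A = Z.
  move=> ZHA; apply/setP => x; rewrite !inE; have := subsetP ZHA x; rewrite !inE.
  by case: (x \in A); case: (x \in Z) => //= /(_ isT).
rewrite -cHA -cards_draws -[RHS](card_in_imset (f := setU A)); last first.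
  move=> X Y; rewrite !inE => /andP [XH _] /andP [YH _] e.
  by have := UK X XH; rewrite e UK.
apply: eq_card => X; apply/idP/imsetP => [|[Y]].
  rewrite inE => /and3P [AX XH /eqP cX]; exists (X :\: A); last by rewrite setUDK.
  by rewrite inE setSD // cardsD (setIidPr AX) cX eqxx.
rewrite inE => /andP [YHA /eqP cY] ->; rewrite inE subsetUl subUset AH.
rewrite (subset_trans YHA) ?subsetDl //= cardsU cY.
suff -> : A :&: Y = set0 by rewrite cards0; apply/eqP; lia.
apply/setP => x; rewrite !inE; apply/negP => /andP [xA /(subsetP YHA)].
by rewrite inE xA.
Qed.

Lemma mul_expn2_eq a b c n : a * 2 ^ b = 2 ^ c -> b + n = c -> a = 2 ^ n.
Proof.
move=> e ec; apply/eqP; rewrite -(@eqn_pmul2r (2 ^ b)) ?expn_gt0 // e -ec.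
by rewrite addnC expnD.
Qed.

Lemma card_small_subsets (T : finType) (B : {set T}) k :
  #|[set A : {set T} | (A \subset B) && (#|A| < k)]| = \sum_(i < k) 'C(#|B|, i).
Proof.
elim: k => [|k IH].
  by rewrite big_ord0; apply/eqP; rewrite cards_eq0; apply/eqP/setP => A; rewrite !inE andbF.
rewrite big_ord_recr /= -IH -cards_draws.
rewrite -[LHS](cardsID [set A : {set T} | #|A| < k]); congr (_ + _); apply: eq_card => A.
  by rewrite !inE -andbA; congr (_ && _); rewrite ltnS; lia.
by rewrite !inE ltnS -leqNgt andbC -andbA -eqn_leq eq_sym.
Qed.

Lemma subset_of_card (T : finType) (A : {set T}) k : k <= #|A| ->
  exists2 X : {set T}, X \subset A & #|X| = k.
Proof.
rewrite -bin_gt0 -cards_draws => /card_gt0P [X]; rewrite inE => /andP [XA /eqP cX].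
by exists X.
Qed.

(** * The types of flats of the Golay matroid *)

(** Pairs of the rank and the size of a flat. A flat of type (k, k) is independent, one
    of type (r, r + 1) is an octad with r - 7 more points, one of type (10, 12)
    consists of three tetrads of a sextet, and the hyperplanes are the dodecads, of
    type (11, 12), and the complements of octads, of type (11, 16). *)
Definition flat_types : seq (nat * nat) :=
  [seq (k, k) | k <- iota 0 11] ++
  [:: (7, 8); (8, 9); (9, 10); (10, 12); (11, 12); (11, 16); (12, 24)].

(** The number of octads inside a flat; with fewer than 12 points it equals the
    nullity. *)
Definition oct_of_type (p : nat * nat) : nat :=
  if p.2 < 12 then p.2 - p.1
  else if p == (10, 12) then 3
  else if p == (11, 16) then 30
  else if p == (12, 24) then 759 else 0.

(** For m <= 11, the number of dependent m-subsets of a set of s points with o octads: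
    each of them contains exactly one octad. *)
Definition ndep m s o := if m < 8 then 0 else o * 'C(s - 8, m - 8).

(** The size of the dependent flats of rank r, for 7 <= r <= 10; there are none of
    smaller rank. *)
Definition dep_size r := if r == 10 then 12 else r.+1.

Lemma int_of_Z_nat n : int_of_Z (Z.of_nat n) = Posz n.
Proof. exact: (Z_of_intK (Posz n)). Qed.

Definition pascal_row n : seq Z := iter n (fun s => add_coefs (0%R :: s) s) [:: 1%R].

Definition binomialZ n k : Z := nth 0%R (pascal_row n) k.

Lemma nth_add_coefs s t i :
  nth 0%R (add_coefs s t) i = (nth 0 s i + nth 0 t i)%R.
Proof.
elim: s t i => [|a s IH] [|b t] [|i] //=; rewrite ?add0r ?addr0 //; exact: IH.
Qed.

Lemma binomialZE n k : binomialZ n k = Z.of_nat 'C(n, k).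
Proof.
rewrite /binomialZ; elim: n k => [|n IH] k; first by case: k => [|[|k]].
rewrite -[pascal_row n.+1]/(add_coefs (0%R :: pascal_row n) (pascal_row n)) nth_add_coefs IH.
case: k => [|k]; first by rewrite !bin0.
by rewrite /= IH binS -[LHS]/(Z.add _ _); clear; lia.
Qed.

Definition ndepZ m s o : Z :=
  if m < 8 then 0%R else (Z.of_nat o * binomialZ (s - 8) (m - 8))%R.

Lemma ndepZE m s o : ndepZ m s o = Z.of_nat (ndep m s o).
Proof.
rewrite /ndepZ /ndep; case: ifP => // _; rewrite binomialZE -[LHS]/(Z.mul _ _).
by clear; lia.
Qed.

(** The number of flats of type p inside a flat of type q. In the last case, d counts
    the dependent flats of rank r. A flat of type (10, 12) has 12 dependent subsets of
    size 11 and 48 independent subsets of size 10; for the other dependent flats of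
    rank r these numbers are 1 for size r + 1 and 8 for size r. *)
Definition count_by_type (p q : nat * nat) : Z :=
  let: (r, s) := p in let: (rH, sH) := q in
  if rH <= r then (if p == q then 1 else 0)%R
  else if r == 11 then Z.of_nat (if s == 12 then 2576 else 759)
  else
    let o := oct_of_type q in
    let d := if r == 10 then Z.div (ndepZ 11 sH o) 12 else ndepZ r.+1 sH o in
    if s == r then
      Z.sub (Z.sub (binomialZ sH r) (ndepZ r sH o)) (Z.mul (Z.of_nat (if r == 10 then 48 else 8)) d)
    else d.

Lemma dep_constants r : r <= 10 ->
  [/\ ndep r.+1 r (oct_of_type (r, r)) = 0,
      ndep r.+1 (dep_size r) (oct_of_type (r, dep_size r)) =
        (if r < 7 then 0 else if r == 10 then 12 else 1),
      'C(r, r) - ndep r r (oct_of_type (r, r)) = 1 &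
      'C(dep_size r, r) - ndep r (dep_size r) (oct_of_type (r, dep_size r)) =
        (if r < 7 then r.+1 else if r == 10 then 48 else 8)].
Proof. by move: r; do 11!case=> //. Qed.

Section Coefficients.
Local Open Scope Z_scope.

(** In the order of flat_types, the sums of the polynomials P_(M/F) over the flats F of
    one type; the first row is P_M. *)
Definition golay_KL_rows : seq (seq Z) :=
  [:: [:: 1; 3311; 162656; 2419692; 6722716; 2923921];
      [:: 24; 42504; 1609080; 16291176; 26807880; 3825360];
      [:: 276; 255024; 7076916; 45114960; 36271092];
      [:: 2024; 949256; 17993360; 63917920; 16236528];
      [:: 10626; 2443980; 28477680; 45319890];
      [:: 42504; 4547928; 27372576; 11731104];
      [:: 134596; 6056820; 13558776];
      [:: 340032; 5100480; 1700160];
      [:: 637560; 1912680];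
      [:: 566720];
      [:: 170016];
      [:: 759; 10626; 15180];
      [:: 12144];
      [:: 91080];
      [:: 35420];
      [:: 2576];
      [:: 759];
      [:: 1]].

Definition golay_Z_coefs : seq Z :=
  [:: 1; 3335; 205436; 4285820; 31050690; 95326605; 137174576; 95326605; 31050690; 4285820;
      205436; 3335; 1].

End Coefficients.

Definition golay_KL_coefs (p : nat * nat) : seq Z :=
  nth [::] golay_KL_rows (index p flat_types).

Lemma golay_table_check : table_check flat_types fst count_by_type 12 golay_KL_coefs.
Proof. by vm_compute. Qed.

Lemma golay_Z_coefsE :
  Z_coefs flat_types fst count_by_type golay_KL_coefs (0, 0) = golay_Z_coefs.
Proof. by vm_compute. Qed.

(** * Golay codes *)

(** The supports of the words of a binary [24, 12, 8] code. *)
Definition golay_supports (T : finType) (C : {set {set T}}) :=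
  [/\ #|T| = 24, linear_code C, #|C| = 2 ^ 12 &
      forall A, A \in C -> A != set0 -> 8 <= #|A|].

Section GolayCode.
Variables (T : finType) (C : {set {set T}}).
Hypothesis golC : golay_supports C.
Implicit Types (A B J X Y W : {set T}).

Let cardT : #|T| = 24. Proof. by case: golC. Qed.
Let linC : linear_code C. Proof. by case: golC. Qed.
Let cardC : #|C| = 2 ^ 12. Proof. by case: golC. Qed.
Let minC A : A \in C -> A != set0 -> 8 <= #|A|.
Proof. by case: golC => _ _ _; apply. Qed.
Let codeD A B : A \in C -> B \in C -> A :+: B \in C.
Proof. by move=> AC BC; case: linC => _; apply. Qed.

Definition octads := [set A in C | #|A| == 8].

Lemma code_eq A B : A \in C -> B \in C -> #|A :+: B| < 8 -> A = B.
Proof.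
move=> AC BC lt; apply: symdiff_eq0; apply/eqP; apply: contraLR lt => ne.
by rewrite -leqNgt minC ?codeD.
Qed.

Lemma octad_code A : A \in octads -> A \in C.
Proof. by rewrite inE => /andP []. Qed.

Lemma card_octad A : A \in octads -> #|A| = 8.
Proof. by rewrite inE => /andP [_ /eqP]. Qed.

Lemma octad_unique X A B : A \in octads -> B \in octads ->
  X \subset A -> X \subset B -> 4 < #|X| -> A = B.
Proof.
move=> Ao Bo XA XB cX; apply: code_eq; rewrite ?octad_code //.
have := card_symdiff A B; rewrite (card_octad Ao) (card_octad Bo).
have : #|X| <= #|A :&: B| by apply: subset_leq_card; rewrite subsetI XA.
by lia.
Qed.

(** Sphere packing. Puncture the code at a point i of X. The 2^12 spheres of radius 3
    in the remaining 23 points are disjoint and have 2^11 elements each, so they fill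
    the space. The center of the sphere that contains X minus i comes from the octad. *)
Lemma octad_through X : #|X| = 5 -> exists2 A, A \in octads & X \subset A.
Proof.
move=> cX; have /set0Pn [i iX] : X != set0 by rewrite -cards_eq0 cX.
pose E := [set e : {set T} | (e \subset ~: [set i]) && (#|e| < 4)].
pose f (p : {set T} * {set T}) := (p.1 :+: p.2) :\ i.
have cI : #|~: [set i]| = 23 by have := cardsC [set i]; rewrite cards1 cardT; lia.
have cE : #|E| = 2 ^ 11.
  by rewrite card_small_subsets cI !big_ord_recl big_ord0; vm_compute.
have memf c e c' e' x : x != i -> f (c, e) = f (c', e') ->
    (x \in c) (+) (x \in e) = (x \in c') (+) (x \in e').
  by move=> xi /setP /(_ x); rewrite !inE xi.
have inj : {in setX C E &, injective f}.
  move=> [c e] [c' e']; rewrite !in_setX /= => /andP [cC eE] /andP [cC' eE'] eq.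
  move: eE eE'; rewrite !inE => /andP [ei ce] /andP [ei' ce'].
  have ecc : c = c'.
    apply: code_eq => //.
    have sub : c :+: c' \subset i |: (e :|: e').
      apply/subsetP => x; rewrite !inE; have [//|xi /=] := eqVneq x i.
      have := memf _ _ _ _ _ xi eq.
      by case: (x \in c); case: (x \in c'); case: (x \in e); case: (x \in e').
    apply: leq_ltn_trans (subset_leq_card sub) _.
    have := cardsU1 i (e :|: e'); have := (leq_card_setU e e').1.
    by case: (_ \notin _) => /=; lia.
  congr (_, _) => //; apply/setP => x; have [->|xi] := eqVneq x i.
    apply/idP/idP => h; [have := subsetP ei _ h | have := subsetP ei' _ h];
    by rewrite !inE eqxx.
  have := memf _ _ _ _ _ xi eq; rewrite ecc.
  by case: (x \in c'); case: (x \in e); case: (x \in e').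
have onto : f @: setX C E = powerset (~: [set i]).
  apply/eqP; rewrite eqEcard card_powerset cI card_in_imset // cardsX cardC cE.
  rewrite -expnD leqnn andbT; apply/subsetP => _ /imsetP [p _ ->].
  by rewrite inE; apply/subsetP => x; rewrite !inE => /andP [].
have : X :\ i \in f @: setX C E.
  by rewrite onto inE; apply/subsetP => x; rewrite !inE => /andP [].
case/imsetP => -[c e]; rewrite in_setX => /andP [/= cC eE] eX.
move: eE; rewrite inE => /andP [ei ce].
have symX x : x != i -> (x \in c :+: X) = (x \in e).
  move=> xi; have /setP /(_ x) := eX; rewrite !inE xi /= => ->.
  by case: (x \in c); case: (x \in e).
(* X and c differ by e, up to the point i. *)
have le4 : #|c :+: X| <= 4.
  have sub : c :+: X \subset i |: e.
    apply/subsetP => x xs; rewrite in_setU1; have [//|xi /=] := eqVneq x i.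
    by rewrite -symX.
  apply: leq_trans (subset_leq_card sub) _.
  by rewrite cardsU1; case: (_ \notin _) => /=; lia.
have c0 : c != set0.
  apply: contraTneq le4 => ->; suff -> : set0 :+: X = X by rewrite cX.
  by apply/setP => x; rewrite !inE.
have c8 := minC cC c0; have := card_symdiff c X; rewrite cX => eqc.
have Xc : X \subset c.
  suff /eqP : c :&: X = X by move/eqP/setIidPr.
  by apply/eqP; rewrite eqEcard subsetIr cX; lia.
exists c => //; rewrite inE cC /= eqn_leq c8 andbT.
(* Now i lies in both X and c, so they differ by at most three points. *)
have sub : c :+: X \subset e.
  apply/subsetP => x; have [->|xi] := eqVneq x i; last by rewrite symX.
  by rewrite inE iX (subsetP Xc _ iX).
have := subset_leq_card sub; rewrite (setIidPr Xc) cX in eqc; lia.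
Qed.

(** The octads through a 4-set X partition the other points; each of those that meet W
    in X and one more point uses up three points outside W. *)
Lemma tetrad_bound X Y W : #|X| = 4 -> X \subset W -> Y \subset W ->
  {in Y, forall y, y \notin X} ->
  (forall y A, y \in Y -> A \in octads -> y |: X \subset A -> A :&: W = y |: X) ->
  3 * #|Y| + #|W| <= 24.
Proof.
move=> cX XW YW YX hW.
pose o y := odflt set0 [pick A in octads | y |: X \subset A].
have oP y : y \in Y -> o y \in octads /\ y |: X \subset o y.
  move=> yY; rewrite /o; case: pickP => [A /andP []//|none].
  have [A Ao yA] := @octad_through (y |: X) ltac:(by rewrite cardsU1 YX // cX).
  by have := none A; rewrite Ao yA.
have le : \sum_(y in Y) #|o y :&: ~: W| <= #|~: W|.
  under eq_bigr do rewrite -sum1_card.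
  rewrite (exchange_big_dep (mem (~: W))) /=; last by move=> y z _ /setIP [].
  rewrite -sum1_card; apply: leq_sum => z; rewrite inE => zW.
  rewrite (eq_bigl (mem [set y in Y | z \in o y])); last by move=> y; rewrite !inE zW andbT.
  rewrite sum1_card; apply/card_le1P => y; rewrite inE => /andP [yY zo] y'; rewrite !inE.
  apply/idP/eqP => [/andP [yY' zo']|->]; last by rewrite yY zo.
  have [oy Xy] := oP y yY; have [oy' Xy'] := oP y' yY'.
  have zX : z \notin X by apply: contra zW => /(subsetP XW).
  have e : o y = o y'.
    apply: (@octad_unique (z |: X)) => //; last by rewrite cardsU1 zX cX.
      by rewrite subUset sub1set zo (subset_trans _ Xy) // subsetUr.
    by rewrite subUset sub1set zo' (subset_trans _ Xy') // subsetUr.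
  have e1 := hW _ _ yY oy Xy; have e2 := hW _ _ yY' oy' Xy'.
  have : y' \in y |: X by rewrite -e1 e e2 setU11.
  by rewrite in_setU1 (negPf (YX _ yY')) orbF => /eqP.
have eq3 : \sum_(y in Y) #|o y :&: ~: W| = 3 * #|Y|.
  rewrite mulnC -sum_nat_const; apply: eq_bigr => y yY; have [oy Xy] := oP y yY.
  have yX := YX _ yY; have e := hW _ _ yY oy Xy.
  have := cardsID W (o y); rewrite e cardsU1 yX cX (card_octad oy) setDE /=; lia.
by have := cardsC W; rewrite cardT; lia.
Qed.

Lemma code_dist A B : A \in C -> B \in C -> A != B -> 8 <= #|A :+: B|.
Proof. by move=> AC BC; apply: contraR; rewrite -ltnNge => /(code_eq AC BC) ->. Qed.

Lemma octad_meet_le4 A B : A \in octads -> B \in octads -> A != B -> #|A :&: B| <= 4.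
Proof.
move=> Ao Bo; apply: contraR; rewrite -ltnNge => lt; apply/eqP.
by apply: octad_unique lt => //; [apply: subsetIl | apply: subsetIr].
Qed.

(** An octad with five points in a word A of weight 10 has no sixth one, as adding it to
    A would give weight below 8. So the six octads through four points of A and one of
    the others need 18 points outside A, and only 14 are left. *)
Lemma code_no_weight10 A : A \in C -> #|A| != 10.
Proof.
move=> AC; apply/eqP => cA.
have [X XA cX] := @subset_of_card _ A 4 ltac:(by rewrite cA).
have cY : #|A :\: X| = 6 by have := cardsID X A; rewrite (setIidPr XA) cX cA; lia.
suff : 3 * #|A :\: X| + #|A| <= 24 by rewrite cY cA.
apply: (tetrad_bound cX) => //; first exact: subsetDl.
  by move=> y; rewrite inE => /andP [].
move=> y B; rewrite inE => /andP [yX yA] Bo yXB.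
apply/esym/eqP; rewrite eqEcard subsetI yXB subUset sub1set yA XA /=.
rewrite cardsU1 yX cX.
have ne : B != A by apply: contra_eq_neq (card_octad Bo) => ->; rewrite cA.
have := code_dist (octad_code Bo) AC ne; have := card_symdiff B A.
by rewrite (card_octad Bo) cA; lia.
Qed.

(** Octads that share three points add up to a word of weight 10. If A and B share a
    single point, take four points of A outside B, and an octad D through them and a
    point of B outside A. D meets B in that point only: three common points are
    already excluded, and two or four would give D + (A + B) weight 10 or 6. The seven
    choices of the point need 21 points outside A and B, and only 9 are left. *)
Lemma octad_meet_even A B : A \in octads -> B \in octads -> ~~ odd #|A :&: B|.
Proof.
move=> Ao Bo; have [->|ne] := eqVneq A B; first by rewrite setIid card_octad.
have no3 D E : D \in octads -> E \in octads -> #|D :&: E| != 3.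
  move=> Do Eo; apply/eqP => e3; have := card_symdiff D E.
  have := code_no_weight10 (codeD (octad_code Do) (octad_code Eo)).
  by rewrite (card_octad Do) (card_octad Eo) e3; lia.
have le4 := octad_meet_le4 Ao Bo ne; have n3 := no3 _ _ Ao Bo.
suff n1 : #|A :&: B| != 1 by lia.
apply/eqP => e1.
have cAB : #|A :\: B| = 7 by have := cardsID B A; rewrite e1 (card_octad Ao); lia.
have cBA : #|B :\: A| = 7 by have := cardsID A B; rewrite setIC e1 (card_octad Bo); lia.
have [X XAB cX] := @subset_of_card _ (A :\: B) 4 ltac:(by rewrite cAB).
have XA : X \subset A := subset_trans XAB (subsetDl _ _).
have XB x : x \in X -> x \notin B by move/(subsetP XAB); rewrite inE => /andP [].
have cW : #|A :|: B| = 15 by have := cardsUI A B; rewrite e1 (card_octad Ao) (card_octad Bo); lia.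
suff : 3 * #|B :\: A| + #|A :|: B| <= 24 by rewrite cBA cW.
apply: (tetrad_bound cX).
- by rewrite (subset_trans XA) // subsetUl.
- by rewrite (subset_trans (subsetDl _ _)) // subsetUr.
- by move=> y; rewrite inE => /andP [yA _]; apply: contra yA => /(subsetP XA).
move=> y D; rewrite inE => /andP [yA yB] Do; rewrite subUset sub1set => /andP [yD XD].
have neA : D != A by apply: contraNneq yA => <-.
have /set0Pn [x0 x0X] : X != set0 by rewrite -cards_eq0 cX.
have neB : D != B by apply: contraNneq (XB _ x0X) => <-; apply: (subsetP XD).
have eDA : D :&: A = X.
  apply/esym/eqP; rewrite eqEcard subsetI XD XA /= cX.
  exact: octad_meet_le4.
have cDB : #|D :&: B| = 1.
  have le : #|D :&: B| <= 4 by apply: octad_meet_le4.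
  have n3' := no3 _ _ Do Bo.
  have pos : 0 < #|D :&: B| by apply/card_gt0P; exists y; rewrite inE yD.
  have cS : #|A :+: B| = 14.
    by have := card_symdiff A B; rewrite e1 (card_octad Ao) (card_octad Bo); clear; lia.
  have SC : A :+: B \in C by rewrite codeD ?octad_code.
  move: cS SC; set S := A :+: B => cS SC.
  have cDS : #|D :&: S| = 4 + #|D :&: B|.
    have -> : D :&: S = (D :&: A) :+: (D :&: B).
      by apply/setP => x; rewrite !inE; case: (x \in D).
    have := card_symdiff (D :&: A) (D :&: B); rewrite {2 3}eDA cX.
    suff -> : X :&: (D :&: B) = set0 by rewrite cards0; clear; lia.
    apply/setP => x; rewrite !inE; apply/negP => /and3P [xX _ xB].
    by have := XB _ xX; rewrite xB.
  have neS : D != S by apply: contra_eq_neq (card_octad Do) => ->; rewrite cS.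
  have := code_dist (octad_code Do) SC neS.
  have := code_no_weight10 (codeD (octad_code Do) SC).
  have := card_symdiff D S; rewrite cDS cS (card_octad Do).
  by move: le n3' pos; clear; lia.
have eDB : D :&: B = [set y].
  by apply/esym/eqP; rewrite eqEcard sub1set inE yD yB cDB cards1.
by rewrite setIUr eDA eDB setUC.
Qed.

(** Every word is reached from 0 by adding octads: a nonzero word has five
    points on a common octad, and adding that octad lowers the weight. *)
Lemma code_doubly_even A : A \in C ->
  (4 %| #|A|) /\ (forall B, B \in octads -> ~~ odd #|A :&: B|).
Proof.
have [n] := ubnP #|A|; elim: n A => // n IH A lt AC.
have [->|A0] := eqVneq A set0.
  by rewrite cards0; split=> // B _; rewrite set0I cards0.
have A8 := minC AC A0.
have [X XA cX] := @subset_of_card _ A 5 ltac:(by lia).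
have [O Oo XO] := octad_through cX.
have AOC := codeD AC (octad_code Oo).
have le5 : 5 <= #|A :&: O| by rewrite -cX subset_leq_card // subsetI XA.
have eqA := card_symdiff A O; rewrite (card_octad Oo) in eqA.
have [d4 ev] := IH (A :+: O) ltac:(by lia) AOC.
have evO := ev _ Oo.
have eqA' := card_symdiff (A :+: O) O; rewrite symdiffK (card_octad Oo) in eqA'.
split; first by move: d4 evO eqA'; lia.
move=> B Bo; rewrite -(symdiffK A O) odd_symdiffI (negPf (ev _ Bo)).
exact: octad_meet_even.
Qed.

Lemma code_dvd4 A : A \in C -> 4 %| #|A|.
Proof. by case/code_doubly_even. Qed.

(** Words whose weights and whose sum have weights divisible by 4 meet evenly. *)
Lemma golay_self_dual : dual_code C = C.
Proof.
apply: self_dual => //; last by rewrite cardC cardT -expnD; congr (2 ^ _).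
apply/subsetP => A AC; rewrite inE; apply/forall_inP => B BC.
have := card_symdiff B A; have := code_dvd4 AC; have := code_dvd4 BC.
by have := code_dvd4 (codeD BC AC); lia.
Qed.

Lemma code_setT : setT \in C.
Proof.
rewrite -golay_self_dual inE; apply/forall_inP => A AC; rewrite setIT.
by have := code_dvd4 AC; lia.
Qed.

Lemma code_setC A : A \in C -> ~: A \in C.
Proof.
move=> AC; suff -> : ~: A = A :+: setT by rewrite codeD ?code_setT.
by apply/setP => x; rewrite !inE addbT.
Qed.

Lemma code_weights A : A \in C -> #|A| \in [:: 0; 8; 12; 16; 24].
Proof.
move=> AC; have [->|A0] := eqVneq A set0; first by rewrite cards0.
have [->|A1] := eqVneq A setT; first by rewrite cardsT cardT.
have cA0 : ~: A != set0 by apply: contraNneq A1 => e; rewrite -(setCK A) e setC0.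
have := minC AC A0; have := minC (code_setC AC) cA0; have := code_dvd4 AC.
have := cardsC A; rewrite cardT !inE; clear; lia.
Qed.

(** Each of the 'C(24, 5) five-point sets lies in exactly one octad. *)
Lemma card_octads : #|octads| = 759.
Proof.
suff e : 'C(8, 5) * #|octads| = 'C(24, 5).
  have := bin_ffact 24 5; rewrite -e !ffactnS ffactn0 /=.
  have -> : 'C(8, 5) = 56 by [].
  have -> : 5`! = 120 by [].
  by clear; lia.
rewrite mulnC -sum_nat_const -cardT -cardsT -cards_draws -[RHS]sum1_card.
transitivity (\sum_(A in octads) \sum_(X : {set T} | (X \subset A) && (#|X| == 5)) 1).
  apply: eq_bigr => A Ao; rewrite -(card_octad Ao) -cards_draws -sum1_card.
  by apply: eq_bigl => X; rewrite inE.
rewrite (exchange_big_dep (fun X : {set T} => #|X| == 5)) /=; last by move=> A X _ /andP [].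
apply: eq_big => [X|X /eqP cX]; first by rewrite inE subsetT.
have [A Ao XA] := octad_through cX.
rewrite (big_pred1 A) // => B /=; rewrite cX eqxx andbT.
apply/andP/eqP => [[Bo XB]|->] //.
by apply: octad_unique XB XA _ => //; rewrite cX.
Qed.

(** * The flats of the Golay matroid *)

Section GolayMatroid.
Variable M : matroid T.
Hypothesis groundM : ground M = setT.
Hypothesis indepM : forall J, (J \in indep M) = (#|inside C J| == 1).
Implicit Types (F H : {set T}).

Let set0C : set0 \in C. Proof. by case: linC. Qed.

Let words_rk J : #|inside C J| * 2 ^ rk M J = 2 ^ #|J|.
Proof. exact: card_inside_rk. Qed.
Let words_compl J : #|inside C (~: J)| * 2 ^ rk M J = 2 ^ 12.
Proof. by rewrite (card_inside_compl linC indepM golay_self_dual). Qed.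

Let inside0 J : set0 \in inside C J. Proof. by rewrite inE set0C sub0set. Qed.

Lemma rk_setT : rk M setT = 12.
Proof.
have := words_rk setT; rewrite inside_setT cardC cardsT cardT -expnD => /eqP.
by rewrite eqn_exp2l // => /eqP; lia.
Qed.

Lemma rk_golay_le12 J : rk M J <= 12.
Proof. by rewrite -rk_setT rkS // subsetT. Qed.

Lemma golay_flatT F : F \in flats M -> rk M F = 12 -> F = setT.
Proof.
move=> Ff e; apply: (flat_eq_rk Ff); rewrite ?subsetT ?e ?rk_golay_le12 //.
by rewrite -groundM flat_ground.
Qed.

Definition oct J := #|[set A in octads | A \subset J]|.

(** Weights are divisible by 4. *)
Lemma small_word_octad J A : #|J| <= 11 -> A \in inside C J -> A != set0 -> A \in octads.
Proof.
rewrite inE => cJ /andP [cA AJ] A0; rewrite inE cA /=.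
have := minC cA A0; have := code_dvd4 cA; have := subset_leq_card AJ.
by move: cJ; clear; lia.
Qed.

Lemma card_octadU A B : A \in octads -> B \in octads -> A != B -> 12 <= #|A :|: B|.
Proof.
move=> Ao Bo /(octad_meet_le4 Ao Bo); have := cardsUI A B.
by rewrite (card_octad Ao) (card_octad Bo); clear; lia.
Qed.

(** Two octads share at most four points, so they need twelve. *)
Lemma oct_le1 J : #|J| <= 11 -> oct J <= 1.
Proof.
move=> cJ; apply/card_le1P => A; rewrite inE => /andP [Ao AJ] B; rewrite !inE.
apply/andP/eqP => [[/andP [BC cB] BJ]|->]; last by rewrite AJ; rewrite inE in Ao.
apply/eqP; apply: contraLR cJ => ne; rewrite -ltnNge.
have Bo : B \in octads by rewrite inE BC.
by apply: leq_trans (card_octadU Bo Ao ne) (subset_leq_card _); rewrite subUset BJ.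
Qed.

(** The nullity is the binary logarithm of the number of words inside J, and the only
    nonzero words inside so few points are octads. *)
Lemma rk_small J : #|J| <= 11 -> rk M J + oct J = #|J|.
Proof.
move=> cJ; have e : #|inside C J| = 1 + oct J.
  rewrite (cardsD1 set0) inside0; congr (_ + _); apply: eq_card => A.
  rewrite in_setD1 [RHS]inE; apply/andP/andP => -[h1 h2].
    by rewrite (small_word_octad cJ) //; move: h2; rewrite inE => /andP [].
  split; last by rewrite inE octad_code.
  by rewrite -cards_eq0 (card_octad h1).
have := words_rk J; rewrite e; have := oct_le1 cJ.
case: (oct J) => [|[|//]] _; rewrite ?mul1n -?expnS => /eqP; rewrite eqn_exp2l // => /eqP; lia.
Qed.

Definition words_at J x := [set A in inside C J | x \in A].

Lemma card_words_at_eq J x A : A \in inside C J -> x \in A ->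
  2 * #|words_at J x| = #|inside C J|.
Proof.
move=> AJ xA; have e := card_inside_setD1 linC AJ xA.
suff : #|words_at J x| + #|inside C (J :\ x)| = #|inside C J|.
  by move: e; clear; lia.
rewrite -(cardsID (words_at J x) (inside C J)); congr (_ + _); apply: eq_card => B.
  by rewrite !inE; case: (B \in C); case: (B \subset J).
rewrite !inE subsetD1; case: (B \in C); case: (B \subset J); case: (x \in B) => //.
Qed.

Lemma card_words_at J x : 2 * #|words_at J x| <= #|inside C J|.
Proof.
have [-> //|[A]] := set_0Vmem (words_at J x); first by rewrite cards0.
by rewrite inE => /andP [AJ xA]; rewrite (card_words_at_eq AJ xA).
Qed.

Lemma sum_card_words J :
  \sum_(A in inside C J) #|A| = \sum_(x in J) #|words_at J x|.
Proof.
under eq_bigr do rewrite -sum1_card.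
rewrite (exchange_big_dep (mem J)) /=; last first.
  by move=> A x; rewrite inE => /andP [_ /subsetP]; apply.
by apply: eq_bigr => x _; rewrite -sum1_card; apply: eq_bigl => A; rewrite !inE.
Qed.

Lemma sum_weights_le J : 2 * \sum_(A in inside C J) #|A| <= #|J| * #|inside C J|.
Proof.
rewrite sum_card_words big_distrr -sum_nat_const /=.
by apply: leq_sum => x _; apply: card_words_at.
Qed.

(** If no word outside F contained x, then adding x to F would keep the words outside
    it, hence the rank. *)
Lemma flat_coverC F x : F \in flats M -> x \notin F ->
  exists2 A, A \in inside C (~: F) & x \in A.
Proof.
move=> Ff xF; have [e|[A]] := set_0Vmem (words_at (~: F) x); last first.
  by rewrite inE => /andP [AF xA]; exists A.
have e2 : inside C (~: F) = inside C (~: (x |: F)).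
  apply/setP => A; rewrite setCU setIC -setDE !inE subsetD1 andbA.
  case AF : (_ && _) => //=; apply/esym/negP => xA.
  by have := in_set0 A; rewrite -e !inE AF xA.
have := words_compl F; rewrite e2 -(words_compl (x |: F)) => /eqP.
have pos : 0 < #|inside C (~: (x |: F))| by apply/card_gt0P; exists set0.
rewrite eqn_pmul2l // eqn_exp2l // => /eqP eq.
by have /flatP [_ /(_ x)] := Ff; rewrite groundM in_setT eq ltnn => /(_ isT xF).
Qed.

(** Every point off F lies in half of the words outside F. *)
Lemma sum_coweights F : F \in flats M ->
  2 * \sum_(A in inside C (~: F)) #|A| = #|~: F| * #|inside C (~: F)|.
Proof.
move=> Ff; rewrite sum_card_words big_distrr -sum_nat_const /=.
apply: eq_bigr => x; rewrite inE => xF; have [A AF xA] := flat_coverC Ff xF.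
exact: card_words_at_eq AF xA.
Qed.

Lemma card_inside_rkC J n : rk M J + n = 12 -> #|inside C (~: J)| = 2 ^ n.
Proof. exact: mul_expn2_eq (words_compl J). Qed.

Lemma card_inside_null J n : rk M J + n = #|J| -> #|inside C J| = 2 ^ n.
Proof. exact: mul_expn2_eq (words_rk J). Qed.

Lemma sum_inside_nonzero J :
  \sum_(A in inside C J) #|A| = \sum_(A in inside C J :\ set0) #|A|.
Proof. by rewrite (big_setD1 set0) ?inside0 //= cards0. Qed.

Lemma card_inside_nonzero J : #|inside C J| = (#|inside C J :\ set0|).+1.
Proof. by rewrite (cardsD1 set0) inside0. Qed.

(** There is one nonzero word outside F, and it has to cover the complement. *)
Lemma hyperplane_word F : F \in flats M -> rk M F = 11 -> ~: F \in C.
Proof.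
move=> Ff rF; have n2 : #|inside C (~: F)| = 2 by rewrite (@card_inside_rkC F 1) ?rF.
have := sum_coweights Ff; rewrite n2 sum_inside_nonzero.
move: n2; rewrite card_inside_nonzero => -[/eqP/cards1P [D eD]].
have : D \in inside C (~: F) :\ set0 by rewrite eD inE.
rewrite !inE => /and3P [_ DC DF]; rewrite eD big_set1 => e.
suff -> : ~: F = D by [].
by apply/esym/eqP; rewrite eqEcard DF; move: e; clear; lia.
Qed.

Lemma rk_leq_card J : rk M J <= #|J|.
Proof. by have [B [_ BJ <-]] := rk_ex M J; apply: subset_leq_card. Qed.

Definition flat_type F := (rk M F, #|F|).

Lemma subset_rk_small F k : k <= 11 -> k <= #|F| -> k <= (rk M F).+1.
Proof.
move=> k11 kF; have [X XF cX] := subset_of_card kF.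
have := @rk_small X; have := @oct_le1 X; rewrite cX => /(_ k11) o1 /(_ k11).
by have := rkS M XF; move: o1; clear; lia.
Qed.

Lemma subset_rk_tiny F k : k <= 7 -> k <= #|F| -> k <= rk M F.
Proof.
move=> k7 kF; have [X XF cX] := subset_of_card kF.
have := @rk_small X; rewrite cX => /(_ ltac:(by apply: leq_trans k7 _)).
suff -> : oct X = 0 by rewrite addn0 => <-; apply: rkS.
apply: eq_card0 => A; rewrite !inE; apply/negP => /andP [/andP [_ /eqP c8] AX].
by have := subset_leq_card AX; rewrite c8 cX; move: k7; clear; lia.
Qed.

(** In rank 11 the complement is a word. In rank 10 the three nonzero words outside F
    cover every point twice, so the complement has at least 12 points, and an even number
    because weights are divisible by 4. In lower rank, up to 11 points of F have
    nullity at most 1, and up to 7 points have nullity 0. *)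
Lemma flat_type_in F : F \in flats M -> flat_type F \in flat_types.
Proof.
move=> Ff; have := rk_golay_le12 F; rewrite leq_eqVlt => /orP [/eqP r12|lt12].
  by rewrite /flat_type r12 (golay_flatT Ff r12) cardsT cardT.
have cF := cardsC F; rewrite cardT in cF; have lerk := rk_leq_card F.
have [r11|n11] := eqVneq (rk M F) 11.
  have := code_weights (hyperplane_word Ff r11).
  have nT : #|~: F| != 0.
    rewrite cards_eq0; apply/eqP => e; have := rk_setT.
    by rewrite -setC0 -e setCK r11.
  rewrite /flat_type r11 !inE => w.
  suff /orP [/eqP ->|/eqP ->] : (#|F| == 12) || (#|F| == 16) by [].
  by move: w nT cF lerk; rewrite r11; clear; lia.
have [r10|n10] := eqVneq (rk M F) 10.
  have n4 : #|inside C (~: F)| = 4 by rewrite (@card_inside_rkC F 2) ?r10.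
  have := sum_coweights Ff; rewrite n4.
  have d4 : 4 %| \sum_(A in inside C (~: F)) #|A|.
    by apply: dvdn_sum => A; rewrite inE => /andP [cA _]; apply: code_dvd4 cA.
  have : 24 <= \sum_(A in inside C (~: F)) #|A|.
    have c3 : #|inside C (~: F) :\ set0| = 3.
      by move: n4; rewrite card_inside_nonzero => -[].
    rewrite sum_inside_nonzero.
    apply: (@leq_trans (\sum_(A in inside C (~: F) :\ set0) 8)).
      by rewrite sum_nat_const c3.
    by apply: leq_sum => A; rewrite !inE => /and3P [A0 cA _]; apply: minC.
  rewrite /flat_type r10 => w e.
  suff /orP [/eqP ->|/eqP ->] : (#|F| == 10) || (#|F| == 12) by [].
  by move: d4 w e cF lerk; rewrite r10; clear; lia.
have r9 : rk M F <= 9 by move: lt12 n11 n10; clear; lia.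
have le1 : #|F| <= (rk M F).+1.
  rewrite leqNgt; apply/negP => lt.
  by have := @subset_rk_small F (rk M F).+2; rewrite ltnn => h; have := h _ lt; lia.
rewrite /flat_type; have [e|ne] := eqVneq #|F| (rk M F).
  by rewrite e; move: r9; case: (rk M F) => [|[|[|[|[|[|[|[|[|[|]]]]]]]]]].
have e : #|F| = (rk M F).+1 by move: le1 lerk ne; clear; lia.
have r7 : 7 <= rk M F.
  rewrite leqNgt; apply/negP => lt.
  have := @subset_rk_tiny F (rk M F).+1 lt; rewrite e ltnn => h.
  by have := h (leqnn _).
by rewrite e; move: r9 r7; case: (rk M F) => [|[|[|[|[|[|[|[|[|[|]]]]]]]]]].
Qed.

Lemma nonzero_insideP J A :
  reflect [/\ A \in C, A \subset J & A != set0] (A \in inside C J :\ set0).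
Proof. by rewrite !inE; apply: (iffP and3P) => -[]. Qed.

Lemma oct_nonzero J :
  (forall A, A \in inside C J :\ set0 -> #|A| = 8) -> oct J = #|inside C J :\ set0|.
Proof.
move=> h; apply: eq_card => A; rewrite inE; apply/andP/nonzero_insideP.
  by case=> Ao AJ; rewrite octad_code // -cards_eq0 (card_octad Ao).
by case=> cA AJ A0; rewrite inE cA h //; apply/nonzero_insideP.
Qed.

(** The three nonzero words inside F have total weight at most 24, since each point lies
    in at most half of the four words. *)
Lemma oct_10_12 F : rk M F = 10 -> #|F| = 12 -> oct F = 3.
Proof.
move=> rF cF; have n4 : #|inside C F| = 4 by rewrite (@card_inside_null F 2) ?rF ?cF.
have c3 : #|inside C F :\ set0| = 3 by move: n4; rewrite card_inside_nonzero => -[].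
rewrite oct_nonzero ?c3 // => A AF; have /nonzero_insideP [cA _ A0] := AF.
have := sum_weights_le F; rewrite n4 cF sum_inside_nonzero (big_setD1 A) //=.
have : 2 * 8 <= \sum_(B in (inside C F :\ set0) :\ A) #|B|.
  have c2 : #|(inside C F :\ set0) :\ A| = 2 by move: c3; rewrite (cardsD1 A) AF => -[].
  apply: (@leq_trans (\sum_(B in (inside C F :\ set0) :\ A) 8)).
    by rewrite sum_nat_const c2.
  apply: leq_sum => B; rewrite in_setD1 => /andP [_ /nonzero_insideP [cB _ B0]].
  exact: minC.
have := minC cA A0; have := code_dvd4 cA; clear.
by move: (\sum_(B in (inside C F :\ set0) :\ A) #|B|) => S; lia.
Qed.

Lemma hyperplane_in_code F : F \in flats M -> rk M F = 11 -> F \in C.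
Proof. by move=> Ff rF; rewrite -(setCK F) code_setC // hyperplane_word. Qed.

(** The only nonzero word inside F is F itself. *)
Lemma oct_11_12 F : F \in flats M -> rk M F = 11 -> #|F| = 12 -> oct F = 0.
Proof.
move=> Ff rF cF; have n2 : #|inside C F| = 2 by rewrite (@card_inside_null F 1) ?rF ?cF.
have FI : F \in inside C F :\ set0.
  by apply/nonzero_insideP; rewrite hyperplane_in_code // -cards_eq0 cF.
move: n2; rewrite card_inside_nonzero => -[/eqP/cards1P [D eD]].
apply: eq_card0 => A; rewrite inE; apply/negP => /andP [Ao AF].
have : A \in inside C F :\ set0.
  by apply/nonzero_insideP; rewrite octad_code // -cards_eq0 (card_octad Ao).
move: FI; rewrite eD !inE => /eqP <- /eqP e.
by have := card_octad Ao; rewrite e cF.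
Qed.

(** F is a word, so another nonzero word inside F and its complement in F both have
    weight at least 8. *)
Lemma oct_11_16 F : F \in flats M -> rk M F = 11 -> #|F| = 16 -> oct F = 30.
Proof.
move=> Ff rF cF; have n32 : #|inside C F| = 32 by rewrite (@card_inside_null F 5) ?rF ?cF.
have FC := hyperplane_in_code Ff rF.
have FI : F \in inside C F :\ set0 by apply/nonzero_insideP; rewrite -cards_eq0 cF.
have c30 : #|(inside C F :\ set0) :\ F| = 30.
  move: n32; rewrite card_inside_nonzero => -[].
  by rewrite (cardsD1 F) FI => -[].
rewrite -c30; apply: eq_card => A; rewrite inE in_setD1; apply/andP/andP.
  case=> Ao AF; split; first by apply: contra_eq_neq (card_octad Ao) => ->; rewrite cF.
  by apply/nonzero_insideP; rewrite octad_code // -cards_eq0 (card_octad Ao).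
case=> ne /nonzero_insideP [cA AF A0]; split=> //; rewrite inE cA /=.
have := card_symdiff A F; have := code_dist cA FC ne; have := minC cA A0.
by rewrite (setIidPl AF) cF; clear; lia.
Qed.

Lemma oct_flat F : F \in flats M -> oct F = oct_of_type (flat_type F).
Proof.
move=> Ff; rewrite /oct_of_type /=; case: ltnP => [lt|ge].
  by have := rk_small (lt : #|F| <= 11); clear; lia.
have : flat_type F \in [seq p <- flat_types | 12 <= p.2].
  by rewrite mem_filter ge flat_type_in.
rewrite !inE !xpair_eqE.
case/or4P => /andP [/eqP r /eqP c]; rewrite r c /=.
- exact: oct_10_12.
- exact: oct_11_12.
- exact: oct_11_16.
rewrite (golay_flatT Ff r) -card_octads; apply: eq_card => A.
by rewrite inE subsetT andbT.
Qed.

Lemma sum_oct_subsets m H :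
  \sum_(X : {set T} | (X \subset H) && (#|X| == m)) oct X = ndep m #|H| (oct H).
Proof.
under eq_bigr do rewrite /oct -sum1_card.
rewrite (exchange_big_dep (mem [set A in octads | A \subset H])) /=; last first.
  by move=> X A /andP [XH _]; rewrite !inE => /andP [-> AX]; rewrite (subset_trans AX).
rewrite /ndep; case: ltnP => [m8|m8].
  rewrite big1 // => A; rewrite inE => /andP [Ao _]; apply: big1 => X.
  rewrite inE Ao /= => /andP [/andP [_ /eqP cX] AX]; have := subset_leq_card AX.
  by rewrite cX (card_octad Ao) leqNgt m8.
rewrite -sum_nat_const; apply: eq_bigr => A; rewrite inE => /andP [Ao AH].
rewrite -[in RHS](card_octad Ao) -card_supersets ?(card_octad Ao) // -sum1_card.
by apply: eq_bigl => X; rewrite [in LHS]in_set Ao in_set andbC.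
Qed.

(** Up to 11 points have nullity 0 or 1, and the nullity is the number of octads. *)
Lemma card_rank_dep m H : m < 11 ->
  #|rank_subsets M m.+1 m H| = ndep m.+1 #|H| (oct H).
Proof.
move=> m11; rewrite -sum_oct_subsets -sum1_card big_mkcond [RHS]big_mkcond /=.
apply: eq_bigr => X _; rewrite inE andbA.
case: (boolP ((X \subset H) && (#|X| == m.+1))) => //= /andP [_ /eqP cX].
have := @rk_small X; have := @oct_le1 X; rewrite cX => /(_ m11) o1 /(_ m11).
by case: eqP; move: o1; clear; lia.
Qed.

Lemma card_rank_indep m H : m <= 11 ->
  #|rank_subsets M m m H| + ndep m #|H| (oct H) = 'C(#|H|, m).
Proof.
move=> m11; rewrite -sum_oct_subsets -cards_draws -[RHS]sum1_card [RHS]big_mkcond.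
rewrite -[X in X + _]sum1_card [X in X + _]big_mkcond [X in _ + X]big_mkcond -big_split /=.
apply: eq_bigr => X _; rewrite !inE andbA.
case: (boolP ((X \subset H) && (#|X| == m))) => //= /andP [_ /eqP cX].
have := @rk_small X; have := @oct_le1 X; rewrite cX => /(_ m11) o1 /(_ m11).
by case: eqP; move: o1; clear; lia.
Qed.

Definition flats_of_type p H := [set F in flats M | (flat_type F == p) && (F \subset H)].

Lemma flat_size F : F \in flats M -> rk M F <= 10 ->
  #|F| = rk M F \/ #|F| = dep_size (rk M F).
Proof.
move=> Ff r10; suff : (#|F| == rk M F) || (#|F| == dep_size (rk M F)).
  by case/orP => /eqP; [left | right].
have H : all (fun p => (p.1 <= 10) ==> (p.2 == p.1) || (p.2 == dep_size p.1)) flat_types by [].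
by have := allP H _ (flat_type_in Ff); rewrite /= r10.
Qed.

Lemma sum_rank_type r H (f : nat * nat -> nat) : r <= 10 ->
  \sum_(F in flats M | (rk M F == r) && (F \subset H)) f (flat_type F) =
  #|flats_of_type (r, r) H| * f (r, r) +
  #|flats_of_type (r, dep_size r) H| * f (r, dep_size r).
Proof.
move=> r10; rewrite (bigID (fun F => #|F| == r)) /= -!sum_nat_const; congr (_ + _).
  apply: eq_big => [F|F /andP [/and3P [_ /eqP rF _] /eqP cF]]; last by rewrite /flat_type rF cF.
  by rewrite [RHS]inE xpair_eqE -!andbA; do 2!congr (_ && _); rewrite andbC.
apply: eq_big => [F|F /andP [/and3P [Ff /eqP rF _] cF]]; last first.
  have := flat_size Ff; rewrite rF => /(_ r10) [e|e]; last by rewrite /flat_type rF e.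
  by rewrite e eqxx in cF.
rewrite [RHS]inE xpair_eqE -!andbA; case: (boolP (F \in flats M)) => //= Ff.
case: (eqVneq (rk M F) r) => //= rF; rewrite andbC; congr (_ && _).
have ne : dep_size r != r by rewrite /dep_size; case: (r =P 10) => [->//|_]; clear; lia.
have := flat_size Ff; rewrite rF => /(_ r10) [->|->]; first by rewrite eqxx eq_sym (negPf ne).
by rewrite eqxx ne.
Qed.

(** The subsets of size r + 1 and rank r, sorted by their closures. *)
Lemma count_dependent r H : r <= 10 -> H \in flats M ->
  ndep r.+1 #|H| (oct H) =
  #|flats_of_type (r, r) H| * ndep r.+1 r (oct_of_type (r, r)) +
  #|flats_of_type (r, dep_size r) H| *
    ndep r.+1 (dep_size r) (oct_of_type (r, dep_size r)).
Proof.
move=> r10 Hf; rewrite -card_rank_dep // card_rank_subsets //.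
rewrite -(sum_rank_type H (fun p => ndep r.+1 p.2 (oct_of_type p)) r10).
by apply: eq_bigr => F /andP [Ff _]; rewrite card_rank_dep // oct_flat.
Qed.

(** The subsets of size r: the dependent ones, and the independent ones sorted by their
    closures. *)
Lemma count_independent r H : r <= 10 -> H \in flats M ->
  'C(#|H|, r) = ndep r #|H| (oct H) +
  #|flats_of_type (r, r) H| * ('C(r, r) - ndep r r (oct_of_type (r, r))) +
  #|flats_of_type (r, dep_size r) H| *
    ('C(dep_size r, r) - ndep r (dep_size r) (oct_of_type (r, dep_size r))).
Proof.
move=> r10 Hf; have r11 : r <= 11 by rewrite (leq_trans r10).
rewrite -(card_rank_indep H r11) card_rank_subsets // addnC -addnA; congr (_ + _).
rewrite -(sum_rank_type H (fun p => 'C(p.2, r) - ndep r p.2 (oct_of_type p)) r10).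
apply: eq_bigr => F /andP [Ff _].
by rewrite -(card_rank_indep F r11) -oct_flat // addnK.
Qed.

Lemma flats_of_type0 p H : p \notin flat_types -> #|flats_of_type p H| = 0.
Proof.
move=> pt; apply: eq_card0 => F; rewrite inE; apply/negP => /and3P [Ff /eqP e _].
by rewrite -e flat_type_in in pt.
Qed.

Lemma flats_of_type_low p H : H \in flats M -> rk M H <= p.1 ->
  #|flats_of_type p H| = (p == flat_type H).
Proof.
move=> Hf le; have [->|ne] := eqVneq p (flat_type H).
  rewrite -[RHS]/1 -(cards1 H); apply: eq_card => F; rewrite [LHS]inE [RHS]inE.
  apply/idP/eqP => [/and3P [Ff /eqP [e _] FH]|->]; last by rewrite Hf eqxx subxx.
  by apply: (flat_eq_rk Ff Hf FH); rewrite e.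
apply: eq_card0 => F; rewrite inE; apply/negP => /and3P [Ff /eqP e FH].
have eF : F = H by apply: (flat_eq_rk Ff Hf FH); rewrite -e in le.
by rewrite -e eF eqxx in ne.
Qed.

(** D is a minimal word: a word properly inside D and its complement in D would both
    have weight at least 8. *)
Lemma minimal_word_hyperplane D : D \in C -> D != set0 -> #|D| < 16 ->
  ~: D \in flats M /\ rk M (~: D) = 11.
Proof.
move=> DC D0 lt.
have nz : inside C D :\ set0 = [set D].
  apply/setP => A; rewrite [RHS]inE; apply/nonzero_insideP/eqP => [[cA AD A0]|-> //].
  apply/eqP; apply: contraLR lt => ne; rewrite -leqNgt.
  have := card_symdiff A D; have := code_dist cA DC ne; have := minC cA A0.
  by rewrite (setIidPl AD); clear; lia.
have r11 : rk M (~: D) = 11.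
  have := words_compl (~: D); rewrite setCK card_inside_nonzero nz cards1 -expnS => /eqP.
  by rewrite eqn_exp2l // => /eqP [].
split=> //; apply/flatP; rewrite groundM; split=> [|x _]; first exact: subsetT.
rewrite inE negbK => xD; rewrite r11.
have := words_compl (x |: ~: D); rewrite setCU setCK setIC -setDE.
suff -> : inside C (D :\ x) = [set set0].
  by rewrite cards1 mul1n => /eqP; rewrite eqn_exp2l // => /eqP ->.
apply/setP => A; rewrite [RHS]inE; apply/idP/eqP => [|->]; last exact: inside0.
rewrite inE subsetD1 => /and3P [cA AD xA]; apply/eqP/negPn/negP => A0.
have : A \in inside C D :\ set0 by apply/nonzero_insideP.
by rewrite nz inE => /eqP e; rewrite e xD in xA.
Qed.

Definition words_of_weight k := [set A in C | #|A| == k].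

Lemma card_hyperplanes s : s \in [:: 12; 16] ->
  #|flats_of_type (11, s) setT| = #|words_of_weight (24 - s)|.
Proof.
move=> sP; rewrite -(card_imset _ (@setC_inj T)); apply: eq_card => D.
have s24 : s <= 24 by move: sP; rewrite !inE => /orP [] /eqP ->.
apply/imsetP/idP => [[F]|].
  rewrite inE => /and3P [Ff /eqP [rF cF] _] ->; rewrite inE hyperplane_word //=.
  by apply/eqP; have := cardsC F; rewrite cardT cF; move: s24; clear; lia.
rewrite inE => /andP [DC /eqP cD]; exists (~: D); last by rewrite setCK.
have D0 : D != set0.
  by rewrite -cards_eq0 cD; move: sP; rewrite !inE => /orP [] /eqP ->.
have lt : #|D| < 16 by rewrite cD; move: sP; rewrite !inE => /orP [] /eqP ->.
have [Ff rF] := minimal_word_hyperplane DC D0 lt.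
rewrite inE Ff subsetT andbT /= /flat_type rF xpair_eqE eqxx /=.
by have := cardsC D; rewrite cardT cD; move: s24; clear; lia.
Qed.

Lemma card_words_of_weight8 : #|words_of_weight 8| = 759.
Proof. exact: card_octads. Qed.

Lemma card_words_of_weightC k : k <= 24 -> #|words_of_weight (24 - k)| = #|words_of_weight k|.
Proof.
move=> k24; rewrite -(card_imset _ (@setC_inj T)); apply: eq_card => D.
apply/imsetP/idP => [[A]|].
  rewrite inE => /andP [cA /eqP wA] ->; rewrite inE code_setC //=.
  by have := cardsC A; rewrite cardT wA; move: k24; clear; lia.
rewrite inE => /andP [cD /eqP wD]; exists (~: D); last by rewrite setCK.
by rewrite inE code_setC //=; have := cardsC D; rewrite cardT wD; move: k24; clear; lia.
Qed.

Lemma card_words_of_weight12 : #|words_of_weight 12| = 2576.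
Proof.
have w0 : #|words_of_weight 0| = 1.
  rewrite -(cards1 (set0 : {set T})); apply: eq_card => A; rewrite !inE cards_eq0 andbC.
  by case: eqP => // ->.
have w24 := card_words_of_weightC (isT : 0 <= 24); rewrite w0 in w24.
have w16 := card_words_of_weightC (isT : 8 <= 24); rewrite card_words_of_weight8 in w16.
have : #|C| = \sum_(k <- [:: 0; 8; 12; 16; 24]) #|words_of_weight k|.
  under eq_bigr do rewrite -sum1_card.
  rewrite (exchange_big_dep (mem C)) /=; last by move=> k A _; rewrite inE => /andP [].
  rewrite -sum1_card; apply: eq_bigr => A cA; apply/esym.
  rewrite (eq_bigl (pred1 #|A|)) => [|k]; last by rewrite inE cA /= eq_sym.
  by rewrite -big_filter sum1_size size_filter count_uniq_mem ?code_weights.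
rewrite !big_cons big_nil cardC w0 w24 w16 card_words_of_weight8.
by move: #|_| => n; rewrite -[2 ^ 12]/4096; clear; lia.
Qed.

(** * The Kazhdan-Lusztig and Z-polynomials of the Golay matroid *)

Lemma card_flats_of_type p H : p \in flat_types -> H \in flats M ->
  Z.of_nat #|flats_of_type p H| = count_by_type p (flat_type H).
Proof.
case: p => r s pT Hf; rewrite /count_by_type /flat_type.
case: leqP => [le|lt].
  rewrite flats_of_type_low // -/(flat_type H); by case: eqP.
have [r11|n11] := eqVneq r 11.
  have HT : H = setT by apply: golay_flatT Hf _; have := rk_golay_le12 H; lia.
  have sP : s \in [:: 12; 16].
    suff : (r, s) \in [seq p <- flat_types | p.1 == 11].
      by rewrite !inE !xpair_eqE r11.
    by rewrite mem_filter pT r11.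
  rewrite r11 HT card_hyperplanes //; move: sP; rewrite !inE => /orP [] /eqP -> /=.
    by rewrite card_words_of_weight12.
  by rewrite card_words_of_weight8.
have r10 : r <= 10 by have := rk_golay_le12 H; lia.
have sP : s = r \/ s = dep_size r.
  have /allP/(_ _ pT) : all (fun p => (p.1 <= 10) ==> (p.2 == p.1) || (p.2 == dep_size p.1))
    flat_types by [].
  by rewrite /= r10 => /orP [] /eqP; [left | right].
have ne : dep_size r != r by rewrite /dep_size; case: (r =P 10) => [->//|_]; clear; lia.
have eo := oct_flat Hf; rewrite /flat_type in eo.
have [c1 c2 c3 c4] := dep_constants r10.
have := count_dependent r10 Hf; have := count_independent r10 Hf.
rewrite c1 c2 c3 c4 eo muln0 add0n muln1 => eI eD.
have low : r < 7 -> #|flats_of_type (r, dep_size r) H| = 0.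
  by move=> r7; apply: flats_of_type0; move: r7; clear; do 7!(case: r => [|r] //).
rewrite !ndepZE binomialZE -!eo.
have dE : (if r == 10 then Z.div (Z.of_nat (ndep 11 #|H| (oct H))) 12
   else Z.of_nat (ndep r.+1 #|H| (oct H))) = Z.of_nat #|flats_of_type (r, dep_size r) H|.
  move: eD low; rewrite -eo; case: ltnP => [r7|r7].
    rewrite muln0 => eD /(_ isT) ->; by rewrite eD; case: eqP r7 => // ->.
  case: (r =P 10) => [->|_] eD _; last by rewrite eD muln1.
  rewrite eD; have -> k : Z.of_nat (k * 12) = Z.mul (Z.of_nat k) 12 by clear; lia.
  by rewrite Z.div_mul.
rewrite dE; case: sP => ->; last by rewrite (negPf ne).
rewrite eqxx; move: eI low; rewrite -eo; case: ltnP => [r7 eI /(_ isT) l|r7 eI _].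
  rewrite eI l mul0n addn0; move: (ndep _ _ _) #|flats_of_type (r, r) H| (if _ then _ else _).
  by clear; lia.
rewrite eI; move: (ndep _ _ _) #|flats_of_type (r, r) H| #|flats_of_type (r, dep_size r) H|.
by case: (r == 10); clear; lia.
Qed.

Lemma golay_rank : rank M = 12.
Proof. by rewrite /rank groundM rk_setT. Qed.

Lemma golay_loopless : loopless M.
Proof.
apply/forall_inP => x _; rewrite indepE cards1 eqn_leq.
rewrite subset_rk_tiny ?cards1 // andbT.
by have := rk_leq_card [set x]; rewrite cards1.
Qed.

Lemma typKL_top a : a \in flat_types -> a.1 = 12 -> typKL M flat_type a = 1%R.
Proof.
move=> aT a12; have ea : a = (12, 24).
  apply/eqP; suff : a \in [seq p <- flat_types | p.1 == 12] by rewrite inE.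
  by rewrite mem_filter aT a12.
rewrite /typKL (big_pred1 setT) => [|F].
  have Tf : setT \in flats M by rewrite -groundM flat_ground.
  have [KL1 _ _] := KL_is_KL (loopless_contr Tf); apply: KL1.
  by have := rank_contr (flat_sub Tf); rewrite rk_setT golay_rank; clear; lia.
apply/andP/eqP => [[Ff /eqP]|->]; first by rewrite ea => -[r12 _]; apply: golay_flatT.
by rewrite -groundM flat_ground ea /flat_type groundM rk_setT cardsT; case: golC => ->.
Qed.

Lemma count_by_typeE p H : p \in flat_types -> H \in flats M ->
  Posz #|[set F in flats M | (flat_type F == p) && (F \subset H)]| =
  int_of_Z (count_by_type p (flat_type H)).
Proof. by move=> pT Hf; rewrite -card_flats_of_type // int_of_Z_nat. Qed.

Lemma golay_typKL a : a \in flat_types ->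
  typKL M flat_type a = zpoly (golay_KL_coefs a).
Proof.
move=> aT.
exact: (@typKL_table _ flat_types fst count_by_type 12 golay_KL_coefs T M flat_type golay_rank
  isT flat_type_in (fun F _ => erefl) count_by_typeE typKL_top a golay_table_check aT).
Qed.

Lemma sum_type00 (f : {set T} -> {poly int}) :
  (\sum_(F in flats M | flat_type F == (0, 0)%N) f F = f set0)%R.
Proof.
apply: big_pred1 => F; apply/andP/eqP => [[_ /eqP [_ /eqP]]|->].
  by rewrite cards_eq0 => /eqP.
by rewrite flat0 ?golay_loopless // /flat_type rk0 cards0.
Qed.

Theorem golay_KL : KL M = zpoly (golay_KL_coefs (0, 0)).
Proof. by rewrite -golay_typKL // /typKL sum_type00 contr0. Qed.

Theorem golay_Zpoly : Zpoly M = zpoly golay_Z_coefs.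
Proof.
rewrite -golay_Z_coefsE zpoly_Z_coefs.
transitivity (typZ M flat_type flat_types fst (fun a b => int_of_Z (count_by_type a b)) (0, 0)).
  rewrite (typZ_sum _ flat_type_in (fun F _ => erefl) count_by_typeE) //.
  by rewrite sum_type00 contr0.
by apply: eq_big_seq => b bT; rewrite golay_typKL.
Qed.

End GolayMatroid.
End GolayCode.

Local Open Scope ring_scope.

(** * Codes and column matroids of generator matrices *)

Lemma F2_cases (x : 'F_2) : x = (x != 0)%:R.
Proof. by case: x => -[|[|//]] i; apply/val_inj. Qed.

Lemma F2_add_neq0 (x y : 'F_2) : (x + y != 0) = (x != 0) (+) (y != 0).
Proof. by case: x => -[|[|//]] i; case: y => -[|[|//]] j. Qed.

Lemma F2_natr_eq0 n : ((n%:R : 'F_2) == 0) = ~~ odd n.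
Proof.
elim: n => [|n IH]; first by rewrite eqxx.
by rewrite -[RHS]/(~~ ~~ odd n) -IH -natr1 -[LHS]negbK F2_add_neq0 oner_eq0 addbT negbK.
Qed.

Section Support.
Variable n : nat.
Implicit Types (u v : 'rV['F_2]_n) (X : {set 'I_n}).

Definition supp v : {set 'I_n} := [set i | v 0 i != 0].

Lemma suppD u v : supp (u + v) = supp u :+: supp v.
Proof. by apply/setP => i; rewrite !inE mxE F2_add_neq0. Qed.

Lemma supp0 : supp 0 = set0.
Proof. by apply/setP => i; rewrite !inE mxE eqxx. Qed.

Lemma supp_inj : injective supp.
Proof.
move=> u v /setP e; apply/rowP => i; have := e i; rewrite !inE => ei.
by rewrite [u 0 i]F2_cases [v 0 i]F2_cases ei.
Qed.

Lemma hamming_dist0 u : hamming_dist u 0 = #|supp u|.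
Proof. by apply: eq_card => i; rewrite !inE mxE. Qed.

Lemma sum_supp u X : (\sum_(j in X) u 0 j == 0) = ~~ odd #|supp u :&: X|.
Proof.
rewrite -F2_natr_eq0 -sumr_const; congr (_ == _).
rewrite big_mkcond [RHS]big_mkcond; apply: eq_bigr => j _.
by rewrite !inE andbC; case: (j \in X) => //=; rewrite {1}[u 0 j]F2_cases; case: (_ != _).
Qed.

End Support.

Section RowCode.
Variables (k n : nat) (G : 'M['F_2]_(k, n)).

Definition row_code : {set {set 'I_n}} := [set supp (w *m G) | w : 'rV['F_2]_k].

Lemma linear_row_code : linear_code row_code.
Proof.
split=> [|A B /imsetP [w _ ->] /imsetP [w' _ ->]].
  by apply/imsetP; exists 0; rewrite // mul0mx supp0.
by apply/imsetP; exists (w + w'); rewrite // mulmxDl suppD.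
Qed.

Lemma card_row_code : row_free G -> #|row_code| = (2 ^ k)%N.
Proof.
move=> Gf; rewrite card_imset; last first.
  by move=> w w' /supp_inj; apply: row_free_inj.
by rewrite card_mx card_Fp // mul1n.
Qed.

(** A set is orthogonal to all words iff it is so to the rows of G. *)
Lemma dual_row_code X : (X \in dual_code row_code) = (\sum_(j in X) col j G == 0).
Proof.
rewrite inE; apply/forall_inP/eqP => [ev|e A /imsetP [w _ ->]].
  apply/colP => i; rewrite summxE mxE.
  have := ev (supp (delta_mx 0 i *m G)) (imset_f _ isT); rewrite -sum_supp => /eqP s0.
  by rewrite -[RHS]s0; apply: eq_bigr => j _; rewrite -rowE !mxE.
rewrite -sum_supp; apply/eqP.
transitivity ((w *m \sum_(j in X) col j G) 0 0); last by rewrite e mulmx0 mxE.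
rewrite mulmx_sumr summxE; apply: eq_bigr => j _.
by rewrite !mxE; apply: eq_bigr => i _; rewrite mxE.
Qed.

(** Over F_2, a linear relation between columns is a set of columns with sum 0. *)
Lemma column_indepE (J : {set 'I_n}) :
  (J \in indep (column_matroid G)) = (#|inside (dual_code row_code) J| == 1%N).
Proof.
have e : [seq col j G | j in J] = [tuple col (enum_val i) G | i < #|J|].
  apply: (@eq_from_nth _ 0) => [|i]; rewrite size_map -cardE ?size_tuple // => lt.
  rewrite (nth_map (enum_val (Ordinal lt))) -?cardE // (nth_mktuple _ 0 (Ordinal lt)).
  by rewrite -(enum_val_nth _ (Ordinal lt)).
have sumE (c : 'I_#|J| -> 'F_2) :
    \sum_(i < #|J|) c i *: [tuple col (enum_val i) G | i < #|J|]`_i =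
    \sum_(j in [set enum_val i | i in [pred i | c i != 0]]) col j G.
  rewrite big_imset /=; last by move=> i i' _ _; apply: enum_val_inj.
  rewrite [RHS]big_mkcond; apply: eq_bigr => i _.
  rewrite nth_mktuple inE {1}[c i]F2_cases.
  by case: (c i != 0); rewrite ?scale1r ?scale0r.
have D0 : set0 \in inside (dual_code row_code) J.
  by rewrite inE sub0set dual_row_code big_set0 eqxx.
rewrite inE e; apply/freeP/cards1P => [fr|[Y eY] c].
  exists set0; apply/setP => X; rewrite [RHS]inE; apply/idP/eqP => [|-> //].
  rewrite inE dual_row_code => /andP [/eqP s0 XJ]; apply/setP => x; rewrite inE.
  apply/negP => xX; have xJ := subsetP XJ _ xX.
  have := fr (fun i => (enum_val i \in X)%:R); rewrite sumE.
  have -> : [set enum_val i | i in [pred i : 'I_#|J| | (enum_val i \in X)%:R != 0 :> 'F_2]] = X.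
    apply/setP => y; apply/imsetP/idP => [|yX].
      case=> i; rewrite inE; case: (boolP (_ \in X)) => [iX _ ->|] //; rewrite eqxx.
    have yJ := subsetP XJ _ yX; exists (enum_rank_in yJ y); last by rewrite enum_rankK_in.
    by rewrite inE enum_rankK_in // yX oner_eq0.
  by move=> /(_ s0 (enum_rank_in xJ x)); rewrite enum_rankK_in // xX => /eqP; rewrite oner_eq0.
rewrite sumE => /eqP s0 i; apply/eqP/negPn/negP => ci.
set X := [set enum_val i | i in _] in s0.
have XD : X \in inside (dual_code row_code) J.
  rewrite inE dual_row_code s0; apply/subsetP => _ /imsetP [i' _ ->]; exact: enum_valP.
have eX : X = set0 by move: XD D0; rewrite eY !inE => /eqP -> /eqP ->.
by have := in_set0 (enum_val i); rewrite -eX imset_f.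
Qed.

End RowCode.

Lemma hamming_dist_supp n (u v : 'rV['F_2]_n) : hamming_dist u v = #|supp (u - v)|.
Proof. by apply: eq_card => i; rewrite !inE !mxE subr_eq0. Qed.

Section GeneratorMatrix.
Variables (C : {vspace 'rV['F_2]_24}) (G : 'M['F_2]_(12, 24)).
Hypotheses (golC : extended_golay_code C) (genG : generator_matrix C G).

Lemma golay_supports_row_code : golay_supports (row_code G).
Proof.
have [_ [_ minC]] := golC; have [Gf memC] := genG.
split; [exact: card_ord | exact: linear_row_code | exact: card_row_code |].
move=> _ /imsetP [w _ ->] nz; rewrite -hamming_dist0; apply: minC.
- by rewrite memC submxMl.
- exact: mem0v.
by apply: contraNneq nz => ->; rewrite supp0.
Qed.

Lemma golay_indepE J :
  (J \in indep (column_matroid G)) = (#|inside (row_code G) J| == 1%N).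
Proof. by rewrite column_indepE (golay_self_dual golay_supports_row_code). Qed.

(** P has the roots -0.0397 +- 0.0118 i and Z the roots -26.04 +- 7.53 i, approximately;
    Laguerre's inequality fails at the nearby points -1/25 and -26. *)
Lemma golay_column_matroid (R : realType) :
  let P : {poly R} := map_poly (intr : int -> R) (KL (column_matroid G)) in
  let Z : {poly R} := map_poly (intr : int -> R) (Zpoly (column_matroid G)) in
  [/\ loopless (column_matroid G), has_nonreal_root P & has_nonreal_root Z].
Proof.
have gol := golay_supports_row_code; split.
- exact: (@golay_loopless _ _ gol _ golay_indepE).
- rewrite (@golay_KL _ _ gol (column_matroid G) erefl golay_indepE).
  by apply: (@laguerre_certificate _ _ (Zneg 1) (Zpos 25)); vm_compute.
rewrite (@golay_Zpoly _ _ gol (column_matroid G) erefl golay_indepE).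
by apply: (@laguerre_certificate _ _ (Zneg 26) (Zpos 1)); vm_compute.
Qed.

End GeneratorMatrix.

(** * A Golay code *)

Section Witness.

Definition xor_bits (a b : bitseq) : bitseq :=
  mkseq (fun j => nth false a j (+) nth false b j) 24.

(** The sum of acc and of the rows selected by w. *)
Fixpoint combination (acc : bitseq) (w : bitseq) (rows : seq bitseq) : bitseq :=
  if rows is r :: rows' then
    combination (if head false w then xor_bits acc r else acc) (behead w) rows'
  else acc.

(** Runs through all selections of rows, sharing partial sums; nz tells whether a row
    has been selected so far. *)
Fixpoint weights_ge8 (rows : seq bitseq) (acc : bitseq) (nz : bool) : bool :=
  if rows is r :: rows' then
    weights_ge8 rows' acc nz && weights_ge8 rows' (xor_bits acc r) true
  else nz ==> (8 <= count id acc)%N.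

Lemma weights_ge8P rows acc nz w : weights_ge8 rows acc nz -> size w = size rows ->
  nz || has id w -> (8 <= count id (combination acc w rows))%N.
Proof.
elim: rows acc nz w => [|r rows IH] acc nz w /=.
  by case: w => // /implyP h _; rewrite orbF.
case/andP=> h0 h1; case: w => // b w [sz] /=; case: b => /= nzw.
  exact: IH h1 sz _.
exact: IH h0 sz nzw.
Qed.

Lemma nth_combination rows acc (w : nat -> bool) j : (j < 24)%N ->
  nth false (combination acc (mkseq w (size rows)) rows) j =
  nth false acc j (+) \big[addb/false]_(i < size rows) (w i && nth false (nth [::] rows i) j).
Proof.
move=> lt; elim: rows acc w => [|r rows IH] acc w; first by rewrite big_ord0 addbF.
rewrite big_ord_recl /=.
have -> : map w (iota 1 (size rows)) = mkseq (w \o S) (size rows).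
  by rewrite /mkseq map_comp -[1%N]/(1 + 0)%N iotaDl.
rewrite IH; case: (w 0%N); rewrite /= ?nth_mkseq // ?addFb //.
by rewrite addbA.
Qed.

(** The shifts of the polynomial 1 + x^2 + x^4 + x^5 + x^6 + x^10 + x^11, which generates
    the binary cyclic Golay code of length 23, and a parity bit in position 23. *)
Definition golay_rows : seq bitseq :=
  [seq mkseq
     (fun j => (j == 23)%N || ((i <= j)%N && ((j - i)%N \in [:: 0; 2; 4; 5; 6; 10; 11]%N))) 24
  | i <- iota 0 12].

Lemma golay_rows_check : weights_ge8 golay_rows (nseq 24 false) false.
Proof. by vm_compute. Qed.

Definition golay_matrix : 'M['F_2]_(12, 24) :=
  \matrix_(i, j) (nth false (nth [::] golay_rows i) j)%:R.

Lemma card_ord_count n (f : nat -> bool) : #|[set j : 'I_n | f j]| = count f (iota 0 n).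
Proof.
by rewrite cardsE cardE /enum_mem size_filter -enumT -val_enum_ord count_map; apply: eq_count.
Qed.

Lemma card_bits (s : bitseq) : size s = 24 -> #|[set j : 'I_24 | nth false s j]| = count id s.
Proof.
move=> sz; rewrite card_ord_count -{2}(take_size s) -(map_nth_iota0 false (leqnn _)).
by rewrite count_map sz.
Qed.

Lemma size_combination rows acc w : size acc = 24 -> size (combination acc w rows) = 24.
Proof.
elim: rows acc w => //= r rows IH acc w sz; apply: IH.
by case: ifP => // _; rewrite size_mkseq.
Qed.

Lemma golay_matrix_weight (w : 'rV['F_2]_12) : w != 0 -> (8 <= #|supp (w *m golay_matrix)|)%N.
Proof.
move=> w0; pose f i := w 0 (inord i) != 0; pose z := nseq 24 false.
have -> : supp (w *m golay_matrix) =
    [set j : 'I_24 | nth false (combination z (mkseq f 12) golay_rows) j].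
  apply/setP => j; have := nth_combination golay_rows z f (ltn_ord j).
  rewrite -[size golay_rows]/12%N nth_nseq if_same addFb !inE mxE => ->.
  rewrite (big_morph (fun x : 'F_2 => x != 0) F2_add_neq0 (erefl : (0 != 0 :> 'F_2) = false)) /=.
  apply: eq_bigr => i _.
  rewrite /f inord_val mxE mulf_eq0 negb_or; congr (_ && _).
  by case: (nth _ _ j).
rewrite card_bits ?size_combination //.
apply: (weights_ge8P golay_rows_check); first by rewrite size_mkseq.
have /rV0Pn [i wi] := w0.
apply/hasP; exists (f i); last by rewrite /f inord_val.
by apply/mapP; exists (val i); rewrite // mem_iota /= ltn_ord.
Qed.

Lemma golay_matrix_free : row_free golay_matrix.
Proof.
rewrite -kermx_eq0; apply/rowV0P => w /sub_kermxP e; apply/eqP/negPn/negP => w0.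
by have := golay_matrix_weight w0; rewrite e supp0 cards0.
Qed.

Lemma golay_code_exists :
  exists (C : {vspace 'rV['F_2]_24}) (G : 'M['F_2]_(12, 24)),
    extended_golay_code C /\ generator_matrix C G.
Proof.
pose f : 'Hom('rV['F_2]_12, 'rV['F_2]_24) := linfun (mulmxr golay_matrix).
have fE w : f w = w *m golay_matrix by rewrite lfunE.
have memC u : (u \in limg f) = (u <= golay_matrix)%MS.
  apply/memv_imgP/submxP => [[w _ ->]|[w ->]]; first by exists w; rewrite fE.
  by exists w; rewrite ?memvf ?fE.
exists (limg f), golay_matrix; split; last by split; [exact: golay_matrix_free |].
have dist u v : u \in limg f -> v \in limg f -> u != v -> (8 <= hamming_dist u v)%N.
  move=> uC vC; rewrite -subr_eq0 hamming_dist_supp.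
  have /memv_imgP [w _ ->] : u - v \in limg f by rewrite memvB.
  rewrite fE => nz; apply: golay_matrix_weight; apply: contraNneq nz => ->.
  by rewrite mul0mx.
split.
  rewrite limg_dim_eq ?dimvf //; apply/eqP; rewrite -subv0; apply/subvP => w.
  rewrite memv_cap memv_ker fE => /andP [_ /eqP e]; rewrite memv0.
  apply/negPn/negP => w0; have := golay_matrix_weight w0.
  by rewrite e supp0 cards0.
split=> //; exists (row 0 golay_matrix), 0.
have r0 : row 0 golay_matrix \in limg f by rewrite memC row_sub.
have w8 : hamming_dist (row 0 golay_matrix) 0 = 8.
  rewrite hamming_dist0.
  transitivity (count id (nth [::] golay_rows 0)); last by [].
  rewrite -card_bits //; apply: eq_card => j; rewrite !inE !mxE.
  by case: (nth _ _ j).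
split=> //; first exact: mem0v.
by apply: contra_eq_neq w8 => ->; rewrite hamming_dist0 supp0 cards0.
Qed.

End Witness.

Theorem theorem6p1 (R : realType) :
  (forall (C : {vspace 'rV['F_2]_24}) (G : 'M['F_2]_(12, 24)),
     extended_golay_code C -> generator_matrix C G ->
     let G24 := column_matroid G in
     let P : {poly R} := map_poly (intr : int -> R) (KL G24) in
     let Z : {poly R} := map_poly (intr : int -> R) (Zpoly G24) in
     [/\ loopless G24,
         ~ real_rooted P /\ has_nonreal_root P &
         ~ real_rooted Z /\ has_nonreal_root Z]) /\
  ~ KL_real_rooted_conjecture R /\
  ~ Z_real_rooted_conjecture R.
Proof.
have [C [G [golC genG]]] := golay_code_exists.
have [l rP rZ] := golay_column_matroid golC genG R.
split; [|split].
- move=> C' G' golC' genG' G24 P Z.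
  have [l' rP' rZ'] := golay_column_matroid golC' genG' R.
  by split=> //; split=> //; apply: nonreal_not_real_rooted.
- by move=> conj; apply: nonreal_not_real_rooted rP _; apply: conj.
by move=> conj; apply: nonreal_not_real_rooted rZ _; apply: conj.
Qed.
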